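(* Let $r\ge 3$, $1\le t\le r-2$ and $n\ge 2$ be integers, and put $q:=r-t$. Then \[ \iota_0(t,n;r)=\max\left(\{W_{r,t}(n)\}\cup\left\{A_i(t,n;r):1\le i\le \left\lfloor \tfrac q2\right\rfloor\right\}\right), \] where \[ W_{r,t}(n):=n^q-(n-1)^q+t(n-1) \] and \[ A_i(t,n;r):=n^{q-2i}\sum_{j=0}^i\binom{t+2i}{j}(n-1)^j . \]
   Context: Write $[m]=\{1,\ldots,m\}$. For $\mathbf x=(x_1,\ldots,x_r)$ and $\mathbf y=(y_1,\ldots,y_r)$ in $[n]^r$, let $\operatorname{agr}(\mathbf x,\mathbf y)=\{i\in[r]:x_i=y_i\}$. A family $\mathcal F\subseteq[n]^r$ is $t$-intersecting if $|\operatorname{agr}(\mathbf x,\mathbf y)|\ge t$ for all $\mathbf x,\mathbf y\in\mathcal F$. The fixed-coordinate set of $\mathcal F$ is \[ \bigcap\mathcal F:=\{i\in[r]:\text{all sequences in }\mathcal F\text{ have the same entry in the }i\text{-th coordinate}\}. \] A $t$-intersecting family $\mathcal F$ is non-trivial if $|\bigcap\mathcal F|<t$. Define \[ \iota_0(t,n;r):=\max\{|\mathcal F|:\mathcal F\subseteq[n]^r\text{ is non-trivial and }t\text{-intersecting}\}. \] *)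

(* Defs.v *)
From mathcomp Require Import all_boot.

Set Implicit Arguments.
Unset Strict Implicit.
Unset Printing Implicit Defensive.

(* [n]^r; the alphabet {1, ..., n} and the coordinates {1, ..., r} are
   both numbered from 0. *)
Notation word n r := {ffun 'I_r -> 'I_n}.

Definition agr (n r : nat) (x y : word n r) : {set 'I_r} :=
  [set i | x i == y i].

Definition t_intersecting (n r t : nat) (F : {set word n r}) : bool :=
  [forall x in F, forall y in F, t <= #|agr x y|].

Definition fixed_coords (n r : nat) (F : {set word n r}) : {set 'I_r} :=
  [set i | [forall x in F, forall y in F, x i == y i]].

Definition nontrivial (n r t : nat) (F : {set word n r}) : bool :=
  #|fixed_coords F| < t.

(* The maximum over an empty collection of families would be 0. *)
Definition iota0 (t n r : nat) : nat :=
  \max_(F : {set word n r} | t_intersecting t F && nontrivial t F) #|F|.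

Definition W (r t n : nat) : nat :=
  let q := r - t in n ^ q - (n - 1) ^ q + t * (n - 1).

Definition A (i t n r : nat) : nat :=
  let q := r - t in
  n ^ (q - 2 * i) * \sum_(0 <= j < i.+1) 'C(t + 2 * i, j) * (n - 1) ^ j.

(* Main.v *)
Require Import Defs.
From mathcomp Require Import all_boot all_order all_algebra perm.
From mathcomp Require Import lra ring zify.

(* Put q = r - t. Compressing all letters to 0 replaces a family of words by the
   family H of the sets of nonzero coordinates of its members: unions of two
   members of H have at most q elements, S carries the weight (n - 1)^|S|, and H
   is non-trivial when its members cover more than q coordinates. If a
   compression of words or a shift of H destroys non-triviality, the family
   splits into two nonempty cross-intersecting ones, and their total weight is
   at most W. Otherwise H may be taken to be a downset that is shifted towards a
   coordinate m.

   Such an H can be replaced by a family on one coordinate less with q lowered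
   by 1, at the cost of a factor 1 + rho (rho = n - 1) in the weight: call S
   pivotal if S is in H and S + m is not. Only disjoint pivotal sets whose sizes
   add up to q obstruct the replacement, and if q = 2s they can be handled by
   averaging when s(rho - 1) >= t - 1. If this condition fails, all sets of size
   at most s are optimal on t + 2s coordinates. To see this, let rho be a real
   number >= 1. The comparison with the optimal family is monotone in rho, so
   that one only needs the largest rho with s(rho - 1) <= t - 1, where two
   coordinates can be removed without loss. This gives the bounds A_i for
   n <= t + 1. For n >= t + 2 the same removal works for all q, except when it
   makes the family trivial, and then the family is contained in the extremal
   family of weight W. *)

Set Implicit Arguments.
Unset Strict Implicit.
Unset Printing Implicit Defensive.

Import Order.TTheory GRing.Theory Num.Theory.

(** * Compressions *)

(** One operation serves for zeroing letters of words ([swap_letter]) and for shifting sets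
    ([swap_elt]): [U] marks what is to be moved along the involution [phi]. *)
Definition compress_map (X : finType) (phi : X -> X) (U : pred X)
    (F : {set X}) (x : X) : X :=
  if U x && (phi x \notin F) then phi x else x.

Definition compress (X : finType) (phi : X -> X) (U : pred X)
    (F : {set X}) : {set X} :=
  compress_map phi U F @: F.

Lemma compress_map_inj (X : finType) (phi : X -> X) (U : pred X)
    (F : {set X}) :
  involutive phi -> {in F &, injective (compress_map phi U F)}.
Proof.
move=> phiK x y xF yF; rewrite /compress_map.
case: ifP => [/andP[_ nx]|_]; case: ifP => [/andP[_ ny]|_] //.
- exact: (can_inj phiK).
- by move=> e; rewrite e yF in nx.
- by move=> e; rewrite -e xF in ny.
Qed.

Lemma card_compress (X : finType) (phi : X -> X) (U : pred X) (F : {set X}) :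
  involutive phi -> #|compress phi U F| = #|F|.
Proof. by move=> phiK; rewrite card_in_imset //; apply: compress_map_inj. Qed.

Lemma compressP (X : finType) (phi : X -> X) (U : pred X) (F : {set X}) y :
  y \in compress phi U F ->
  (exists x, [/\ x \in F, U x & y = phi x]) \/
  (y \in F /\ (U y -> phi y \in F)).
Proof.
case/imsetP => x xF ->; rewrite /compress_map; case: ifP.
  by case/andP=> Ux nx; left; exists x.
move/negbT; rewrite negb_and negbK => h; right; split=> // Ux.
by rewrite Ux in h.
Qed.

Lemma compress_rel (X : finType) (phi : X -> X) (U : pred X) (e : rel X)
    (F : {set X}) :
  involutive phi -> symmetric e ->
  (forall x y, e (phi x) (phi y) = e x y) ->
  (forall y, ~~ U y -> ~~ U (phi y) -> phi y = y) ->
  (forall x y, U x -> U (phi y) -> e x y -> e (phi x) y) ->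
  {in F &, forall x y, e x y} ->
  {in compress phi U F &, forall x y, e x y}.
Proof.
move=> phiK sym inv neu mono eF.
(* Here [x] moves and [z] stays. If [U z], then [phi z] is in [F] and invariance leaves
   [e x (phi z)]; if [U (phi z)], [mono] applies; otherwise [phi z = z]. *)
have key x z : x \in F -> U x -> z \in F -> (U z -> phi z \in F) ->
    e (phi x) z.
  move=> xF Ux zF hz; case Uz: (U z).
    by rewrite -(phiK z) inv; apply: eF; rewrite ?hz.
  case Upz: (U (phi z)); first by apply: mono => //; apply: eF.
  by rewrite -(neu z) ?Uz ?Upz // inv eF.
move=> y1 y2 /compressP[[x1 [x1F U1 ->]]|[y1F h1]]
  /compressP[[x2 [x2F U2 ->]]|[y2F h2]].
- by rewrite inv eF.
- exact: key.
- by rewrite sym; exact: key.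
- exact: eF.
Qed.

(** A movable element would make the compression raise the total potential. Hence a family of
    maximal potential is closed under [phi] on [U]. *)
Lemma compress_potential (X : finType) (phi : X -> X) (U : pred X)
    (pot : X -> nat) (F : {set X}) :
  involutive phi -> (forall x, U x -> pot x < pot (phi x)) ->
  \sum_(x in compress phi U F) pot x <= \sum_(x in F) pot x ->
  forall x, x \in F -> U x -> phi x \in F.
Proof.
move=> phiK hpot; rewrite big_imset /=; last exact: compress_map_inj.
move=> le x xF Ux; apply: contraLR le => nx; rewrite -ltnNge.
rewrite [X in X < _](bigD1 x) //= [X in _ < X](bigD1 x) //=.
rewrite {1}/compress_map Ux nx /=.
rewrite -addSn leq_add ?hpot //; apply: leq_sum => y _.
by rewrite /compress_map; case: ifP => // /andP[/hpot/ltnW].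
Qed.

(** * Weights of families of sets *)

Local Open Scope ring_scope.

Definition weight (R : realFieldType) (rho : R) (T : finType)
    (H : {set {set T}}) : R :=
  \sum_(S in H) rho ^+ #|S|.

Definition downset (T : finType) (H : {set {set T}}) : Prop :=
  forall S S' : {set T}, S \subset S' -> S' \in H -> S \in H.

Lemma weight_le (R : realFieldType) (rho : R) (T : finType)
    (H H' : {set {set T}}) :
  0 <= rho -> H \subset H' -> weight rho H <= weight rho H'.
Proof.
move=> rho0 /subsetP sub; rewrite /weight [leRHS](bigID (mem H)) /=.
rewrite [X in X + _](eq_bigl (mem H)) => [|S]; last first.
  by rewrite andbC; case SH: (S \in H) => //=; rewrite sub.
by rewrite lerDl; apply: sumr_ge0 => S _; apply: exprn_ge0.
Qed.

Lemma weight_disjointU (R : realFieldType) (rho : R) (T : finType)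
    (H H' : {set {set T}}) :
  [disjoint H & H'] -> weight rho (H :|: H') = weight rho H + weight rho H'.
Proof.
move=> dis; rewrite /weight (big_setID H) /= setUK; congr (_ + _).
by apply: eq_bigl => S; rewrite setDUl setDv set0U (setDidPl _) // disjoint_sym.
Qed.

Lemma weight_powerset (R : realFieldType) (rho : R) (T : finType)
    (E : {set T}) :
  weight rho (powerset E) = (1 + rho) ^+ #|E|.
Proof.
rewrite exprDn /weight.
rewrite (partition_big (fun S : {set T} => inord #|S| : 'I_#|E|.+1) xpredT) //=.
apply: eq_bigr => i _; rewrite expr1n mul1r -cards_draws -sumr_const.
apply: eq_big => S; rewrite !inE.
  case SE: (S \subset E) => //=.
  by rewrite -val_eqE /= inordK // ltnS subset_leq_card.
by case/andP=> SE /eqP <-; rewrite inordK // ltnS subset_leq_card.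
Qed.

Lemma weight_truncated (R : realFieldType) (rho : R) (T : finType)
    (E : {set T}) (s : nat) :
  weight rho [set S in powerset E | (#|S| <= s)%N] =
  \sum_(j < s.+1) rho ^+ j *+ 'C(#|E|, j).
Proof.
rewrite /weight.
rewrite (partition_big (fun S : {set T} => inord #|S| : 'I_s.+1) xpredT) //=.
apply: eq_bigr => i _; rewrite -cards_draws -sumr_const.
apply: eq_big => S; rewrite !inE.
  case SE: (S \subset E) => //=; case: leqP => Ss /=.
    by rewrite -val_eqE /= inordK // ltnS.
  by symmetry; apply/negbTE; rewrite neq_ltn (leq_trans (ltn_ord i)) ?orbT.
by case/andP=> /andP[_ Ss] /eqP <-; rewrite inordK.
Qed.

(* Double counting of the pairs [S \subset S'] with [#|S| = k] and
   [#|S'| = e - k]. *)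
Lemma downset_level_le (T : finType) (E : {set T}) (H : {set {set T}}) k :
  downset H -> (2 * k <= #|E|)%N ->
  (#|[set S in H | (S \subset E) && (#|S| == #|E| - k)%N]| <=
   #|[set S in H | (S \subset E) && (#|S| == k)]|)%N.
Proof.
move=> dH k2; set e := #|E| in k2 *.
set Hi := [set S in H | _]; set Lo := [set S in H | (S \subset E) && (_ == k)].
have up : (\sum_(S in Hi) 'C(e - k, k) =
           \sum_(S in Hi) \sum_(S' in Lo | S' \subset S) 1)%N.
  apply: eq_bigr => S; rewrite inE => /and3P[SH SE /eqP Se].
  rewrite -Se -cards_draws -sum1_card; apply: eq_bigl => S'; rewrite !inE.
  case S'S: (S' \subset S); rewrite ?andbF //=.
  by rewrite (dH _ _ S'S SH) (subset_trans S'S SE) andbT.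
have dn : (\sum_(S' in Lo) \sum_(S in Hi | (S' \in Lo) && (S' \subset S)) 1 <=
           \sum_(S' in Lo) 'C(e - k, e - 2 * k))%N.
  apply: leq_sum => S' S'Lo; rewrite S'Lo /=.
  move: S'Lo; rewrite inE => /and3P[S'H S'E /eqP S'k].
  rewrite sum1dep_card.
  have -> : (e - k = #|E :\: S'|)%N by rewrite cardsD (setIidPr S'E) S'k.
  rewrite -cards_draws.
  rewrite -(@card_in_imset _ _ (fun S => S :\: S')
    [set S in Hi | S' \subset S]); last first.
    move=> S1 S2; rewrite !inE => /andP[_ s1] /andP[_ s2] e12.
    by rewrite -(setID S1 S') -(setID S2 S') e12 (setIidPr s1) (setIidPr s2).
  apply: subset_leq_card; apply/subsetP => B /imsetP[S]; rewrite !inE.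
  case/andP=> /and3P[_ SE /eqP Se] S'S ->; rewrite setSD //=.
  by rewrite cardsD (setIidPr S'S) S'k Se; apply/eqP; lia.
have := leq_trans (eq_leq up).
rewrite (exchange_big_dep (mem Lo)) /=; last by move=> S S' _ /andP[].
move/(_ _ dn); rewrite !sum_nat_const.
have -> : ('C(e - k, e - 2 * k) = 'C(e - k, k))%N.
  by rewrite -bin_sub; [congr binomial; lia | lia].
by rewrite leq_pmul2r // bin_gt0; lia.
Qed.

Lemma sum_by_card (R : nmodType) (T : finType) (E : {set T})
    (H : {set {set T}}) (f : nat -> R) :
  {in H, forall S : {set T}, S \subset E} ->
  \sum_(S in H) f #|S| =
  \sum_(k < #|E|.+1) f k *+ #|[set S in H | (S \subset E) && (#|S| == k)]|.
Proof.
move=> sub.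
rewrite (partition_big (fun S : {set T} => inord #|S| : 'I_#|E|.+1) xpredT) //=.
apply: eq_bigr => k _; rewrite -sumr_const; apply: eq_big => S.
  rewrite inE; case SH: (S \in H) => //=; rewrite sub //=.
  by rewrite -val_eqE /= inordK // ltnS subset_leq_card ?sub.
by case/andP=> SH /eqP <-; rewrite inordK // ltnS subset_leq_card ?sub.
Qed.

(** Pair the levels [k] and [#|E| - k]: the lower one has at least as many members by
    [downset_level_le], so giving it the larger power of [rho] cannot decrease the sum. The empty
    set is left out because its terms [1] and [rho ^+ #|E|] make the gap in [cross_weight_le]. *)
Lemma downset_weight_le_compl (R : realFieldType) (rho : R) (T : finType)
    (E : {set T}) (H : {set {set T}}) :
  1 <= rho -> downset H -> {in H, forall S : {set T}, S \subset E} ->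
  E \notin H ->
  \sum_(S in H :\ set0) rho ^+ #|S| <=
  \sum_(S in H :\ set0) rho ^+ (#|E| - #|S|).
Proof.
move=> rho1 dH sub nE; set e := #|E|.
have sub' : {in H :\ set0, forall S : {set T}, S \subset E}.
  by move=> S; rewrite inE => /andP[_]; apply: sub.
rewrite (sum_by_card _ sub') (sum_by_card (fun k => rho ^+ (e - k)) sub').
rewrite -/e.
set p := fun k => #|[set S in H :\ set0 | (S \subset E) && (#|S| == k)]|.
have p_le (k : nat) : (k <= e)%N -> (2 * k <= e)%N -> (p (e - k) <= p k)%N.
  case: k => [|k] _ k2.
    (* Level 0 has lost the empty set; level [e] is empty as well since [E \notin H]. *)
    rewrite subn0 /p (_ : [set _ in _ | _] = set0) ?cards0 //.
    apply/setP => S; rewrite !inE; apply/negbTE; apply/negP.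
    case/and3P=> /andP[_ SH] SE /eqP Se; move: nE.
    by rewrite -(_ : S = E) ?SH //; apply/eqP; rewrite eqEcard SE Se leqnn.
  have pE j : (0 < j)%N ->
      p j = #|[set S in H | (S \subset E) && (#|S| == j)]|.
    move=> j0; apply: eq_card => S; rewrite !inE.
    case: (S =P set0) => [->|_] //=.
    by rewrite cards0 eq_sym (gtn_eqF j0) !andbF.
  rewrite !pE //; last by rewrite subn_gt0; lia.
  exact: downset_level_le.
(* Each side is doubled by adding its sum read backwards, which pairs [k] with [e - k]. *)
rewrite -(ler_pM2r (_ : 0 < 2%:R :> R)) ?ltr0n // !mulr_natr !mulr2n.
rewrite [X in X + _ <= _](reindex_inj rev_ord_inj) /=.
rewrite [X in _ <= X + _](reindex_inj rev_ord_inj) /= -!big_split /=.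
apply: ler_sum => -[k /= ke] _; rewrite subSS subKn; last by rewrite -ltnS.
rewrite -/(p k) -/(p (e - k)%N).
have mE (x : R) (j : nat) : x *+ p j = x * (p j)%:R by rewrite mulr_natr.
rewrite !(mE (rho ^+ _)).
have rear (j : nat) : (j <= e)%N -> (2 * j <= e)%N ->
  0 <= (rho ^+ (e - j) - rho ^+ j) * ((p j)%:R - (p (e - j)%N)%:R) :> R.
  move=> je j2; rewrite mulr_ge0 // subr_ge0 ?ler_nat ?p_le //.
  by rewrite ler_weXn2l //; lia.
have [k2|k2] := leqP (2 * k) e.
  by have := rear k ke k2; lra.
have := rear (e - k)%N; rewrite subKn; last by rewrite -ltnS.
by move/(_ (leq_subr _ _)); rewrite (_ : (2 * (e - k) <= e)%N); [lra|lia].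
Qed.

(** Complements in [E] of members of [P] are not in [Q], so they and [Q] together weigh at most
    [(1 + rho) ^+ #|E|]; [downset_weight_le_compl] compares [P] with its complements. *)
Lemma cross_weight_le (R : realFieldType) (rho : R) (T : finType)
    (E : {set T}) (P Q : {set {set T}}) :
  1 <= rho -> downset P -> set0 \in P -> set0 \in Q ->
  {in P, forall S : {set T}, S \subset E} ->
  {in Q, forall S : {set T}, S \subset E} ->
  {in P & Q, forall S S' : {set T}, S :|: S' != E} ->
  weight rho P + weight rho Q <= (1 + rho) ^+ #|E| - rho ^+ #|E| + 1.
Proof.
move=> rho1 dP P0 Q0 PE QE PQ.
have nE : E \notin P.
  by apply/negP => EP; have := PQ _ _ EP Q0; rewrite setU0 eqxx.
have low := downset_weight_le_compl rho1 dP PE nE.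
have compl S : S \in P -> E :\: S \notin Q.
  move=> SP; apply/negP => SQ; have := PQ _ _ SP SQ.
  by rewrite -{1}(setIidPr (PE _ SP)) setID eqxx.
have : weight rho Q + \sum_(S in P) rho ^+ (#|E| - #|S|) <=
       (1 + rho) ^+ #|E|.
  rewrite -weight_powerset /weight.
  have -> : \sum_(S in P) rho ^+ (#|E| - #|S|) =
            weight rho [set E :\: S | S in P].
    rewrite /weight big_imset /=; last first.
      have DK S : S \in P -> E :\: (E :\: S) = S.
        by move=> /PE SE; rewrite setDDr setDv set0U (setIidPr SE).
      by move=> S S' SP S'P e; rewrite -(DK S) // -(DK S') // e.
    apply: eq_bigr => S SP; rewrite cardsD (setIidPr (PE _ SP)) //.
  rewrite -weight_disjointU; last first.
    rewrite disjoint_sym disjoints_subset; apply/subsetP => _ /imsetP[S SP ->].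
    by rewrite inE compl.
  apply: weight_le; first exact: le_trans rho1.
  apply/subsetP => S; rewrite !inE => /orP[/QE //|/imsetP[S' _ ->]].
  exact: subsetDl.
rewrite {2}/weight !(big_setD1 set0 P0) /= cards0 subn0 expr0.
by move: low; lra.
Qed.

(** * Cross-agreeing families of words *)

Definition nonzero (T : finType) (k : nat) (x : {ffun T -> 'I_k.+1}) :
    {set T} :=
  [set i | x i != ord0].

Definition zero_out (T : finType) (k : nat) (S : {set T})
    (x : {ffun T -> 'I_k.+1}) : {ffun T -> 'I_k.+1} :=
  [ffun i => if i \in S then ord0 else x i].

(** A transposition instead of overwriting [a] by zero, so as to have an involution. *)
Definition swap_letter (T : finType) (k : nat) (i : T) (a : 'I_k.+1)
    (x : {ffun T -> 'I_k.+1}) : {ffun T -> 'I_k.+1} :=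
  [ffun j => if j == i then tperm ord0 a (x j) else x j].

(** Each nonzero coordinate has [k] possible letters, so a support [S] belongs to [k ^ #|S|]
    words. *)
Lemma card_nonzero_in (R : realFieldType) (T : finType) (k : nat)
    (H : {set {set T}}) :
  #|[set x : {ffun T -> 'I_k.+1} | nonzero x \in H]|%:R =
  weight (k%:R : R) H.
Proof.
rewrite -sum1_card natr_sum (partition_big (@nonzero T k) (mem H)) /=;
  last by move=> x; rewrite inE.
rewrite /weight; apply: eq_bigr => S SH; rewrite -natrX.
have -> : (k ^ #|S| = #|pffun_on (ord0 : 'I_k.+1) S (predC1 ord0)|)%N.
  by rewrite card_pffun_on cardC1 card_ord.
rewrite -natr_sum sum1_card; congr _%:R.
apply: eq_card => x; rewrite !inE unfold_in /=.
apply/idP/pffun_onP => [/andP[_ /eqP <-]|[sub im]].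
  split; first by apply/subsetP => i; rewrite !inE.
  by move=> _ /imageP[i + ->]; rewrite !inE.
have e : nonzero x = S.
  apply/eqP; rewrite eqEsubset; apply/andP; split; apply/subsetP => i.
    by rewrite inE => xi; apply: (subsetP sub); rewrite inE.
  by move=> iS; rewrite inE; apply: im; apply/imageP; exists i.
by rewrite e eqxx andbT inE e.
Qed.

Lemma card_le_weight (R : realFieldType) (T : finType) (k : nat)
    (F : {set {ffun T -> 'I_k.+1}}) :
  #|F|%:R <= weight (k%:R : R) (@nonzero T k @: F).
Proof.
rewrite -card_nonzero_in ler_nat; apply: subset_leq_card.
by apply/subsetP => x xF; rewrite inE imset_f.
Qed.

Lemma swap_letterK (T : finType) (k : nat) (i : T) (a : 'I_k.+1) :
  involutive (swap_letter i a).
Proof.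
by move=> x; apply/ffunP => j; rewrite !ffunE; case: eqP => // _; rewrite tpermK.
Qed.

Lemma swap_letter_eq (T : finType) (k : nat) (i : T) (a : 'I_k.+1)
    (x y : {ffun T -> 'I_k.+1}) j :
  (swap_letter i a x j == swap_letter i a y j) = (x j == y j).
Proof. by rewrite !ffunE; case: ifP => // _; rewrite (inj_eq perm_inj). Qed.

Lemma swap_letter_fix (T : finType) (k : nat) (i : T) (a : 'I_k.+1)
    (x : {ffun T -> 'I_k.+1}) :
  x i != a -> swap_letter i a x i != a -> swap_letter i a x = x.
Proof.
rewrite ffunE eqxx => xa pa; apply/ffunP => j; rewrite ffunE.
case: eqP => // ->; rewrite tpermD // 1?eq_sym //.
by apply: contra pa => /eqP->; rewrite tpermL.
Qed.

(** The monotonicity asked for by [compress_rel]: [y i] is zero and [x i] is not, so zeroing [x i]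
    destroys no agreement. *)
Lemma swap_letter_agree (T : finType) (k : nat) (i : T) (a : 'I_k.+1)
    (x y : {ffun T -> 'I_k.+1}) j :
  a != ord0 -> x i = a -> swap_letter i a y i = a -> x j = y j ->
  swap_letter i a x j = y j.
Proof.
move=> a0 xi; rewrite !ffunE eqxx; case: eqP => // -> ya.
have -> : y i = ord0 by rewrite -(tpermK ord0 a (y i)) ya tpermR.
by rewrite xi => e; rewrite e eqxx in a0.
Qed.

Lemma swap_letter_zero (T : finType) (k : nat) (i : T)
    (x : {ffun T -> 'I_k.+1}) :
  swap_letter i (x i) x = zero_out [set i] x.
Proof.
by apply/ffunP => j; rewrite !ffunE inE; case: eqP => // ->; rewrite tpermR.
Qed.

Lemma card_nonzero_zero_out (T : finType) (k : nat) (i : T)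
    (x : {ffun T -> 'I_k.+1}) :
  x i != ord0 -> (#|~: nonzero x| < #|~: nonzero (zero_out [set i] x)|)%N.
Proof.
move=> xi; apply: proper_card; apply/properP; split.
  by apply/subsetP => j; rewrite !inE !negbK ffunE => /eqP ->; case: ifP.
by exists i; rewrite !inE ?negbK ?xi // ffunE inE eqxx.
Qed.

Lemma zero_out_closed (T : finType) (k : nat)
    (G : {set {ffun T -> 'I_k.+1}}) :
  (forall x i, x \in G -> x i != ord0 -> zero_out [set i] x \in G) ->
  forall S x, x \in G -> zero_out S x \in G.
Proof.
move=> cl S; move: {2}#|S| (erefl #|S|) => m; elim: m S => [|m IH] S Sm x xG.
  rewrite (cards0_eq Sm); suff -> : zero_out set0 x = x by [].
  by apply/ffunP => j; rewrite ffunE inE.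
have [i iS] : exists i, i \in S by apply/card_gt0P; rewrite Sm.
have Gy : zero_out (S :\ i) x \in G.
  by apply: IH => //; move: Sm; rewrite (cardsD1 i) iS => -[].
have e : zero_out S x = zero_out [set i] (zero_out (S :\ i) x).
  apply/ffunP => j; rewrite !ffunE !inE; case: (j =P i) => // ->.
  by rewrite iS.
case: (zero_out (S :\ i) x i =P ord0) => [y0|/eqP y0]; last by rewrite e cl.
suff -> : zero_out S x = zero_out (S :\ i) x by [].
rewrite e; apply/ffunP => j; rewrite [LHS]ffunE inE; case: eqP => // ->.
by rewrite y0.
Qed.

Lemma nonzero_zero_out (T : finType) (k : nat) (S : {set T})
    (x : {ffun T -> 'I_k.+1}) :
  nonzero (zero_out S x) = nonzero x :\: S.
Proof. by apply/setP => i; rewrite !inE ffunE; case: ifP; rewrite ?eqxx. Qed.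

Lemma zero_out_downset (T : finType) (k : nat)
    (G : {set {ffun T -> 'I_k.+1}}) :
  (forall S x, x \in G -> zero_out S x \in G) ->
  downset (@nonzero T k @: G).
Proof.
move=> cl S S' sub /imsetP[x xG e].
apply/imsetP; exists (zero_out (~: S) x); first exact: cl.
by rewrite nonzero_zero_out setDE setCK -e (setIidPr sub).
Qed.

(** After all letters are compressed to zero, the supports of both families form downsets, and
    supports from different families never cover all coordinates; [cross_weight_le] with [rho = k]
    concludes. *)
Lemma cross_agreeing_card (T : finType) (k : nat)
    (P Q : {set {ffun T -> 'I_k.+1}}) :
  (0 < k)%N -> P != set0 -> Q != set0 ->
  {in P & Q, forall x y : {ffun T -> 'I_k.+1}, [exists j, x j == y j]} ->
  (#|P| + #|Q| + k ^ #|T| <= k.+1 ^ #|T| + 1)%N.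
Proof.
move=> k0 /set0Pn[x0 x0P] /set0Pn[y0 y0Q] PQ.
(* A boolean tag joins both families into one, so that a compression acts on both at once; [e]
   constrains only words with different tags. *)
pose X := ({ffun T -> 'I_k.+1} * bool)%type.
pose e : rel X := fun p q => (p.2 != q.2) ==> [exists j, p.1 j == q.1 j].
pose Inv (F : {set X}) :=
  [&& #|F| == (#|P| + #|Q|)%N, [exists x, (x, true) \in F],
      [exists x, (x, false) \in F] & [forall p in F, forall q in F, e p q]].
pose pot (p : X) := #|~: nonzero p.1|.
have InvP (F : {set X}) : reflect
    [/\ #|F| = (#|P| + #|Q|)%N, exists x, (x, true) \in F,
        exists x, (x, false) \in F & {in F &, forall p q : X, e p q}] (Inv F).
  apply: (iffP and4P) => [[/eqP ? /existsP ? /existsP ? /forall_inP h]|].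
    split=> // p q pF qF; have /forall_inP := h p pF; exact.
  move=> [? ? ? h]; split; [exact/eqP|exact/existsP|exact/existsP|].
  by apply/forall_inP => p pF; apply/forall_inP => q qF; apply: h.
pose F0 : {set X} := [set (x, true) | x in P] :|: [set (x, false) | x in Q].
have F0t x : ((x, true) \in F0) = (x \in P).
  rewrite inE; apply/orP/idP => [[/imsetP[y yP [->]]|/imsetP[]]//|xP].
  by left; apply: imset_f.
have F0f x : ((x, false) \in F0) = (x \in Q).
  rewrite inE; apply/orP/idP => [[/imsetP[]//|/imsetP[y yP [->]]]//|xP].
  by right; apply: imset_f.
have InvF0 : Inv F0.
  apply/InvP; split; [|by exists x0; rewrite F0t|by exists y0; rewrite F0f|].
    rewrite cardsU !card_imset; try by move=> x y [].
    rewrite (_ : _ :&: _ = set0) ?cards0 ?subn0 //.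
    apply/setP => p; rewrite !inE; apply/negbTE/negP.
    by case/andP=> /imsetP[x _ ->] /imsetP[].
  move=> [x b] [y c]; rewrite /e /=; case: b; case: c => //=;
    rewrite ?F0t ?F0f => xF yF; first exact: PQ.
  have /existsP[j /eqP jj] := PQ _ _ yF xF.
  by apply/existsP; exists j; apply/eqP.
case: (arg_maxnP (fun F : {set X} => \sum_(p in F) pot p) InvF0).
move=> F /InvP[cF [x1 x1F] [y1 y1F] eF] maxF.
have closed (b : bool) x i : (x, b) \in F -> x i != ord0 ->
    (zero_out [set i] x, b) \in F.
  move=> xF xi.
  pose phi (p : X) : X := (swap_letter i (x i) p.1, p.2).
  pose U : pred X := fun p => p.1 i == x i.
  have phiK : involutive phi.
    by move=> [y c]; rewrite /phi /= swap_letterK.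
  have -> : (zero_out [set i] x, b) = phi (x, b).
    by rewrite /phi /= swap_letter_zero.
  apply: (@compress_potential _ phi U pot F); rewrite ?/U //=.
    by move=> [y c] /eqP /= yi; rewrite /pot /= -yi swap_letter_zero
      card_nonzero_zero_out // yi.
  have keep c z : (z, c) \in F -> exists y, (y, c) \in compress phi U F.
    move=> /(imset_f (compress_map phi U F)); rewrite /compress_map.
    by case: ifP => _ h; [exists (swap_letter i (x i) z) | exists z].
  apply: maxF; apply/InvP; split.
  - by rewrite card_compress.
  - exact: keep x1F.
  - exact: keep y1F.
  - apply: compress_rel => //.
    + move=> [y c] [z d]; rewrite /e /= eq_sym; congr (_ ==> _).
      by apply: eq_existsb => j; rewrite eq_sym.
    + move=> [y c] [z d]; rewrite /e /=; congr (_ ==> _).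
      by apply: eq_existsb => j; rewrite swap_letter_eq.
    + by move=> [y c]; rewrite /U /phi /= => ? ?; rewrite swap_letter_fix.
    + move=> [y c] [z d] /eqP /= yi /eqP /= zi; rewrite /e /=.
      case: (c != d) => //= /existsP[j /eqP yzj]; apply/existsP; exists j.
      by apply/eqP; apply: swap_letter_agree.
pose G b := [set x | (x, b) \in F].
have Gcl b S x : x \in G b -> zero_out S x \in G b.
  by apply: zero_out_closed => {S}{}x i; rewrite !inE; apply: closed.
pose H b := @nonzero T k @: G b.
have H0 b x : (x, b) \in F -> set0 \in H b.
  move=> xF; apply: (zero_out_downset (Gcl b)) (sub0set (nonzero x)) _.
  by apply: imset_f; rewrite inE.
have HE b : {in H b, forall S : {set T}, S \subset [set: T]}.
  by move=> S _; apply: subsetT.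
have cross : {in H true & H false, forall S S' : {set T}, S :|: S' != [set: T]}.
  move=> _ _ /imsetP[x xG ->] /imsetP[y yG ->].
  (* Once [x] is zeroed on the support of [y], agreement is left only where both original words are
     zero. *)
  have := Gcl _ (nonzero y) _ xG; rewrite !inE in yG * => x'G.
  have /existsP[j /eqP jj] := implyP (eF _ _ x'G yG) isT.
  apply/negP => /eqP/setP/(_ j); rewrite !inE /=.
  move: jj; rewrite /= ffunE inE.
  case: (y j =P ord0) => /= [-> ->|/eqP yj0 yj]; first by rewrite eqxx.
  by rewrite -yj eqxx in yj0.
have := cross_weight_le (_ : 1 <= k%:R :> rat) (zero_out_downset (Gcl true))
  (H0 _ _ x1F) (H0 _ _ y1F) (HE true) (HE false) cross.
rewrite ler1n => /(_ k0) bound.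
have : #|F|%:R <= weight (k%:R : rat) (H true) + weight k%:R (H false).
  apply: le_trans (lerD (card_le_weight _ _) (card_le_weight _ _)).
  rewrite -natrD ler_nat.
  rewrite -(@card_imset _ _ (fun x => (x, true)) (G true));
    last by move=> ? ? [].
  rewrite -(@card_imset _ _ (fun x => (x, false)) (G false));
    last by move=> ? ? [].
  apply: leq_trans (leq_card_setU _ _).
  apply: subset_leq_card; apply/subsetP => -[x b] xF; rewrite inE.
  by apply/orP; case: b xF => xF; [left|right]; apply: imset_f; rewrite inE.
rewrite cF => /le_trans/(_ bound).
rewrite cardsT -(ler_nat rat) !natrD !natrX.
by rewrite -[k.+1%:R]natr1 [k%:R + 1]addrC; lra.
Qed.

(** * Removing a coordinate *)

Definition union_bounded (T : finType) (q : nat) (H : {set {set T}}) : bool :=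
  [forall S in H, forall S' in H, (#|S :|: S'| <= q)%N].

Definition shifted (T : finType) (m : T) (H : {set {set T}}) : Prop :=
  forall S l, S \in H -> l \in S -> m \notin S -> m |: (S :\ l) \in H.

Definition stable_part (T : finType) (m : T) (H : {set {set T}}) :=
  [set S in H | (m \notin S) && (m |: S \in H)].

Definition pivotal_part (T : finType) (m : T) (H : {set {set T}}) :=
  [set S in H | (m \notin S) && (m |: S \notin H)].

Lemma union_boundedP (T : finType) (q : nat) (H : {set {set T}}) :
  reflect {in H &, forall S S' : {set T}, (#|S :|: S'| <= q)%N}
    (union_bounded q H).
Proof.
apply: (iffP forall_inP) => [h S S' SH S'H|h S SH].
  by have /forall_inP := h S SH; apply.
by apply/forall_inP => S' S'H; apply: h.
Qed.

Lemma weight_ge0 (R : realFieldType) (rho : R) (T : finType)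
    (H : {set {set T}}) :
  0 <= rho -> 0 <= weight rho H.
Proof. by move=> rho0; apply: sumr_ge0 => S _; apply: exprn_ge0. Qed.

(** In a downset the members through [m] are the sets [m |: S] with [S] stable. *)
Lemma weight_split (R : realFieldType) (rho : R) (T : finType) (m : T)
    (H : {set {set T}}) :
  downset H ->
  weight rho H =
  weight rho [set S in H | m \notin S] + rho * weight rho (stable_part m H).
Proof.
move=> dH; set N := stable_part m H.
have <- : weight rho [set m |: S | S in N] = rho * weight rho N.
  rewrite /weight big_imset /=; last first.
    move=> S S'; rewrite !inE => /and3P[_ mS _] /and3P[_ mS' _] e.
    by rewrite -(setU1K mS) -(setU1K mS') e.
  rewrite mulr_sumr; apply: eq_bigr => S; rewrite !inE => /and3P[_ mS _].
  by rewrite cardsU1 mS exprS.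
rewrite -weight_disjointU; last first.
  rewrite disjoint_sym disjoints_subset; apply/subsetP => _ /imsetP[S _ ->].
  by rewrite !inE eqxx /= andbF.
congr weight; apply/setP => S; rewrite !inE; apply/idP/idP => [SH|].
  case mS: (m \in S); last by rewrite SH.
  apply/orP; right; apply/imsetP; exists (S :\ m); last by rewrite setD1K.
  by rewrite inE setD1K // SH (dH _ _ (subD1set _ _) SH) !inE eqxx.
case/orP=> [/andP[]//|/imsetP[S']].
by rewrite inE => /and3P[_ _ ?] ->.
Qed.

Lemma weight_pivot (R : realFieldType) (rho : R) (T : finType) (m : T)
    (H : {set {set T}}) :
  downset H ->
  weight rho H =
  (1 + rho) * weight rho (stable_part m H) + weight rho (pivotal_part m H).
Proof.
move=> dH; rewrite (weight_split _ m dH) mulrDl mul1r addrAC.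
rewrite -weight_disjointU; last first.
  rewrite disjoints_subset; apply/subsetP => S; rewrite !inE.
  by case/and3P=> _ -> ->; rewrite !andbF.
congr (weight _ _ + _); apply/setP => S; rewrite !inE.
by case: (S \in H); case: (m \in S); case: (_ \in H).
Qed.

(* An averaging argument over the [2 s - 1 + t] possible elements [i]. *)
Lemma exists_heavy_star (R : realFieldType) (rho : R) (T : finType)
    (D : {set T}) (M : {set {set T}}) (s t : nat) :
  1 <= rho -> (0 < s)%N -> #|D| = (2 * s + t)%N.-1 ->
  t%:R - 1 <= s%:R * (rho - 1) ->
  {in M, forall S : {set T}, S \subset D /\ #|S| = s} ->
  exists2 i, i \in D &
    weight rho M <= (1 + rho) * weight rho [set S in M | i \in S].
Proof.
move=> rho1 s0 Dc hs MD.
have wE (M' : {set {set T}}) : M' \subset M ->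
    weight rho M' = rho ^+ s * #|M'|%:R.
  move=> /subsetP sub; rewrite /weight mulr_natr -sumr_const.
  by apply: eq_bigr => S /sub/MD[_ ->].
have cnt : (\sum_(i in D) #|[set S in M | i \in S]| = s * #|M|)%N.
  rewrite (eq_bigr (fun i => \sum_(S in M | i \in S) 1)%N); last first.
    by move=> i _; rewrite sum1dep_card.
  rewrite (exchange_big_dep (mem M)) /=; last by move=> i S _ /andP[].
  rewrite (eq_bigr (fun _ => s)) => [|S SM];
    first by rewrite sum_nat_const mulnC.
  have [SD <-] := MD _ SM; rewrite -sum1_card; apply: eq_bigl => i.
  by rewrite SM /=; case iS: (i \in S); rewrite ?andbF // (subsetP SD).
have [[i iD hi]|no] := altP (@exists_inP _ (mem D)
    (fun i => weight rho M <= (1 + rho) * weight rho [set S in M | i \in S])).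
  by exists i.
exfalso; have D0 : (0 < #|D|)%N by lia.
have lt : (1 + rho) * (s * #|M|)%N%:R < (2 * s + t)%N.-1%:R * #|M|%:R :> R.
  rewrite -cnt natr_sum mulr_sumr -Dc.
  have -> : #|D|%:R * #|M|%:R = \sum_(i in D) #|M|%:R :> R.
    by rewrite sumr_const mulr_natl.
  apply: ltr_sum => [|i iD].
    have /card_gt0P[i iD] := D0; apply/hasP; exists i => //.
  move/exists_inP: no => no; rewrite ltNge; apply/negP => le; apply: no.
  exists i => //; rewrite !wE //.
    by rewrite mulrCA ler_pM2l // exprn_gt0 //; lra.
  by apply/subsetP => S; rewrite inE => /andP[].
move: lt; rewrite -subn1 natrB ?natrD ?natrM; last by lia.
rewrite mulrA -subr_gt0 -mulrBl.
have : 0 <= #|M|%:R :> R by rewrite ler0n.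
have : 0 <= (1 + rho) * s%:R - (2 * s%:R + t%:R - 1) by lra.
nra.
Qed.

(* The stable sets are kept. By shiftedness, two pivotal sets whose union has
   [q.+1] elements are disjoint, so their sizes add up to [q.+1]: one can keep
   all pivotal sets larger, or all smaller, than [q.+1 / 2], and among those of
   size exactly [q.+1 / 2] the ones through a common element. *)
Lemma reduce_coordinate (R : realFieldType) (rho : R) (T : finType) (m : T)
    (D : {set T}) (H : {set {set T}}) (q t : nat) :
  1 <= rho -> m \in D -> #|D| = (q.+1 + t)%N ->
  {in H, forall S : {set T}, S \subset D} ->
  downset H -> shifted m H -> union_bounded q.+1 H ->
  (forall s, q.+1 = (2 * s)%N -> t%:R - 1 <= s%:R * (rho - 1)) ->
  exists H' : {set {set T}},
    [/\ {in H', forall S : {set T}, S \subset D :\ m}, union_bounded q H',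
        weight rho H <= (1 + rho) * weight rho H' & stable_part m H \subset H'].
Proof.
move=> rho1 mD Dc HD dH sH /union_boundedP uH hs.
set N := stable_part m H; set P := pivotal_part m H.
have PP S : S \in P -> [/\ S \in H, m \notin S & m |: S \notin H].
  by rewrite inE => /and3P.
pose Lo := [set S in P | (2 * #|S| < q.+1)%N].
pose Hi := [set S in P | (2 * #|S| > q.+1)%N].
pose Mi := [set S in P | (2 * #|S| == q.+1)%N].
have PP' S : S \in P -> S \in H /\ m \notin S by case/PP.
have PD S : S \in P -> S \subset D :\ m.
  by case/PP=> SH mS _; rewrite subsetD1 HD.
(* An intersecting part of the middle level with a share [1 / (1 + rho)] of its weight is enough;
   for odd [q.+1] this level is empty. *)
have [M [MMi Mint wM]] : exists M : {set {set T}}, [/\ M \subset Mi,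
    {in M &, forall S S' : {set T}, ~~ [disjoint S & S']} &
    weight rho Mi <= (1 + rho) * weight rho M].
  case: (boolP (odd q.+1)) => [oq|/negPf eq].
    exists set0; rewrite sub0set; split=> //; first by move=> S; rewrite inE.
    rewrite (_ : Mi = set0) ?/weight ?big_set0 ?mulr0 //.
    by apply/setP => S; rewrite !inE; apply/negbTE/negP; lia.
  have q2 : q.+1 = (2 * q.+1./2)%N by lia.
  have [] := @exists_heavy_star R rho T (D :\ m) Mi q.+1./2 t rho1.
  - by lia.
  - by move: Dc; rewrite (cardsD1 m) mD; lia.
  - exact: hs.
  - by move=> S; rewrite inE => /andP[SP e]; split; [exact: PD|lia].
  move=> i _ wi; exists [set S in Mi | i \in S]; split=> //.
    by apply/subsetP => S; rewrite inE => /andP[].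
  move=> S S'; rewrite !inE => /andP[_ iS] /andP[_ iS'].
  by apply/pred0Pn; exists i; rewrite /= iS iS'.
(* For a common element [l], shifting [l] to [m] in [S] would give a union with [q.+2] elements. *)
have conflict S S' : S \in P -> S' \in P -> #|S :|: S'| = q.+1 ->
    [disjoint S & S'].
  case/PP=> SH mS nS /PP[S'H mS' _] e; apply/pred0Pn => -[l /andP[/= lS lS']].
  have := uH _ _ (sH _ _ SH lS mS) S'H.
  have -> : (m |: S :\ l) :|: S' = m |: (S :|: S').
    apply/setP => j; rewrite !inE -orbA; congr (_ || _).
    by case: (j =P l) => [->|_] //=; rewrite lS lS'.
  by rewrite cardsU1 !inE (negPf mS) (negPf mS') e ltnn.
have [K [KP Kind wK]] : exists K : {set {set T}}, [/\ K \subset P,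
    {in K &, forall S S' : {set T}, (#|S :|: S'| <= q)%N} &
    weight rho P <= (1 + rho) * weight rho K].
  (* The heavier of [Lo] and [Hi] has at least half of their weight, which suffices because
     [2 <= 1 + rho]. *)
  have [B [BP BMi BB wB]] : exists B : {set {set T}},
      [/\ B \subset P, [disjoint B & Mi],
      {in B & B :|: Mi, forall S S' : {set T}, #|S| + #|S'| != q.+1}%N &
      weight rho Lo + weight rho Hi <= weight rho B *+ 2].
    have [le|/ltW le] := leP (weight rho Lo) (weight rho Hi).
      exists Hi; split; last by rewrite mulr2n lerD2r.
      - by apply/subsetP => S; rewrite inE => /andP[].
      - rewrite disjoints_subset; apply/subsetP => S; rewrite !inE.
        by case/andP=> _ lt; rewrite (gtn_eqF lt) !andbF.
      - by move=> S S'; rewrite !inE => /andP[_ c] /orP[] /andP[_ c']; lia.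
    exists Lo; split; last by rewrite mulr2n lerD2l.
    - by apply/subsetP => S; rewrite inE => /andP[].
    - rewrite disjoints_subset; apply/subsetP => S; rewrite !inE.
      by case/andP=> _ lt; rewrite (ltn_eqF lt) !andbF.
    - by move=> S S'; rewrite !inE => /andP[_ c] /orP[] /andP[_ c']; lia.
  have MP : M \subset P.
    by apply: subset_trans MMi _; apply/subsetP => S; rewrite inE => /andP[].
  exists (B :|: M); split; first by rewrite subUset BP MP.
    move=> S S' SK S'K.
    have toP Z : Z \in B :|: M -> Z \in P.
      by case/setUP; [apply: (subsetP BP)|apply: (subsetP MP)].
    have := uH _ _ (proj1 (PP' _ (toP _ SK))) (proj1 (PP' _ (toP _ S'K))).
    rewrite leq_eqVlt ltnS => /orP[/eqP e|//].
    have dis := conflict _ _ (toP _ SK) (toP _ S'K) e.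
    have {e} : (#|S| + #|S'|)%N = q.+1.
      by move: e; rewrite cardsU (disjoint_setI0 dis) cards0 subn0.
    have toBM Z : Z \in B :|: M -> Z \in B :|: Mi.
      by case/setUP=> [ZB|/(subsetP MMi) ZM]; apply/setUP; [left|right].
    case/setUP: (SK) => [SB|SM].
      by move/eqP; rewrite (negPf (BB _ _ SB (toBM _ S'K))).
    case/setUP: (S'K) => [S'B|S'M].
      by rewrite addnC => /eqP; rewrite (negPf (BB _ _ S'B (toBM _ SK))).
    by rewrite (negPf (Mint _ _ SM S'M)) in dis.
  have -> : P = Lo :|: Hi :|: Mi.
    apply/setP => S; rewrite !inE.
    by case: (ltngtP (2 * #|S|) q.+1); rewrite ?andbF ?andbT ?orbF ?orbT.
  have dLH : [disjoint Lo & Hi].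
    rewrite disjoints_subset; apply/subsetP => S; rewrite !inE.
    by case/andP=> _ lt; rewrite ltnNge (ltnW lt) andbF.
  have dM : [disjoint Lo :|: Hi & Mi].
    rewrite disjoints_subset; apply/subsetP => S; rewrite !inE.
    by case/orP=> /andP[_ lt]; rewrite ?(ltn_eqF lt) ?(gtn_eqF lt) andbF.
  rewrite (weight_disjointU _ dM) (weight_disjointU _ dLH).
  rewrite (weight_disjointU _ (disjointWr MMi BMi)).
  have := weight_ge0 B (le_trans ler01 rho1).
  by nra.
exists (N :|: K); split.
- move=> S; rewrite inE => /orP[|/(subsetP KP)/PD //].
  by rewrite inE => /and3P[SH mS _]; rewrite subsetD1 HD.
(* A stable set stays in [H] when [m] is added, so its union with a member avoiding [m] must leave
   room for [m]. *)
- have NN S S' : S \in N -> S' \in N :|: K -> (#|S :|: S'| <= q)%N.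
    rewrite inE => /and3P[SH mS mSH] S'NK.
    have [S'H mS'] : S' \in H /\ m \notin S'.
      by case/setUP: S'NK => [|/(subsetP KP)]; rewrite inE => /and3P[].
    have := uH _ _ mSH S'H.
    by rewrite -setUA cardsU1 !inE (negPf mS) (negPf mS').
  apply/union_boundedP => S S'; rewrite [S \in _]inE => /orP[|SK].
    exact: NN.
  rewrite [S' \in _]inE => /orP[S'N|]; last exact: Kind.
  by rewrite setUC; apply: NN; rewrite // inE SK orbT.
- rewrite (weight_pivot rho m dH) -/N -/P weight_disjointU; last first.
    rewrite disjoints_subset; apply/subsetP => S.
    rewrite !inE => /and3P[SH mS mSH].
    by apply/negP => /(subsetP KP)/PP[_ _]; rewrite mSH.
  by rewrite mulrDr lerD2l.
- exact: subsetUl.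
Qed.

(** * Shifting, and the optimality of balls *)

Definition swap_elt (T : finType) (l m : T) (S : {set T}) : {set T} :=
  tperm l m @^-1: S.

Definition shift_dir (T : finType) (l m : T) : pred {set T} :=
  fun S => (l \in S) && (m \notin S).

Definition shift (T : finType) (l m : T) (H : {set {set T}}) :=
  compress (swap_elt l m) (shift_dir l m) H.

Lemma swap_eltK (T : finType) (l m : T) : involutive (swap_elt l m).
Proof. by move=> S; apply/setP => i; rewrite !inE tpermK. Qed.

Lemma card_swap_elt (T : finType) (l m : T) (S : {set T}) :
  #|swap_elt l m S| = #|S|.
Proof. exact: card_preimset perm_inj. Qed.

Lemma swap_eltE (T : finType) (l m : T) (S : {set T}) :
  shift_dir l m S -> swap_elt l m S = m |: (S :\ l).
Proof.
case/andP=> lS mS; apply/setP => i; rewrite !inE.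
case: tpermP => [->|->|/eqP il /eqP im].
- by rewrite (negPf mS) eqxx orbF; apply/esym/eqP => e; rewrite -e lS in mS.
- by rewrite lS eqxx.
- by rewrite (negPf im) il.
Qed.

Lemma swap_elt_fix (T : finType) (l m : T) (S : {set T}) :
  ~~ shift_dir l m S -> ~~ shift_dir l m (swap_elt l m S) -> swap_elt l m S = S.
Proof.
rewrite /shift_dir !inE tpermL tpermR => h1 h2; apply/setP => i; rewrite !inE.
by case: tpermP => // ->; move: h1 h2; case: (l \in S); case: (m \in S).
Qed.

Lemma weight_shift (R : realFieldType) (rho : R) (T : finType) (l m : T)
    (H : {set {set T}}) :
  weight rho (shift l m H) = weight rho H.
Proof.
rewrite /weight big_imset /=; last exact: compress_map_inj (@swap_eltK _ l m).
by apply: eq_bigr => S _; rewrite /compress_map; case: ifP; rewrite ?card_swap_elt.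
Qed.

Lemma union_bounded_shift (T : finType) (l m : T) (q : nat)
    (H : {set {set T}}) :
  union_bounded q H -> union_bounded q (shift l m H).
Proof.
move/union_boundedP => uH; apply/union_boundedP.
apply: (compress_rel (e := fun S S' => (#|S :|: S'| <= q)%N)) => //.
- exact: swap_eltK.
- by move=> S S'; rewrite setUC.
- by move=> S S'; rewrite -preimsetU card_swap_elt.
- exact: swap_elt_fix.
(* Now [m] is already in [S'], so replacing [l] by [m] in [S] brings no new element into the
   union. *)
move=> S S' US; rewrite /shift_dir !inE tpermL tpermR => /andP[mS' lS'].
rewrite swap_eltE //; apply: leq_trans; apply: subset_leq_card.
apply/subsetP => i; rewrite !inE -orbA => /or3P[/eqP->|/andP[_ ->]//|->].
  by rewrite mS' orbT.
by rewrite orbT.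
Qed.

Lemma union_bounded_add (T : finType) (q : nat) (H : {set {set T}})
    (S S' : {set T}) :
  S \subset S' -> S' \in H -> union_bounded q H -> union_bounded q (S |: H).
Proof.
move=> sub S'H /union_boundedP uH; apply/union_boundedP.
have toH Z : Z \in S |: H -> exists2 Y, Y \in H & Z \subset Y.
  by case/setU1P => [->|ZH]; [exists S'|exists Z].
move=> Z1 Z2 /toH[Y1 Y1H s1] /toH[Y2 Y2H s2].
exact: leq_trans (subset_leq_card (setUSS s1 s2)) (uH _ _ Y1H Y2H).
Qed.

(* Take a family maximizing [\sum_(S in H) (1 + (m \in S))] among those that
   satisfy [I] and have at least the weight of [H0]. *)
Lemma exists_stable (R : realFieldType) (rho : R) (T : finType) (m : T)
    (I : pred {set {set T}}) (H0 : {set {set T}}) :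
  0 <= rho -> I H0 ->
  (forall (H : {set {set T}}) (S S' : {set T}),
      S \subset S' -> S' \in H -> I H -> I (S |: H)) ->
  exists H : {set {set T}},
    [/\ I H, weight rho H0 <= weight rho H, downset H &
        (exists2 l, l != m & ~~ I (shift l m H)) \/ shifted m H].
Proof.
move=> rho0 IH0 Iadd; pose pot (S : {set T}) := (m \in S).+1.
have [|H /andP[IH wH] maxH] := @arg_maxnP _ H0
    (fun H => I H && (weight rho H0 <= weight rho H))
    (fun H => \sum_(S in H) pot S)%N.
  by rewrite IH0 lexx.
exists H; split=> //.
  move=> S S' sub S'H; apply/negPn/negP => nS.
  have := maxH (S |: H); rewrite (Iadd _ _ _ sub S'H IH) /= big_setU1 //=.
  rewrite (le_trans wH) ?weight_le ?subsetUr // => /(_ isT).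
  by rewrite /pot addSn ltnNge leq_addl.
case: (boolP [exists l, (l != m) && ~~ I (shift l m H)]).
  by case/existsP=> l /andP[lm nI]; left; exists l.
rewrite negb_exists => /forallP no; right => S l SH lS mS.
have lm : l != m by apply: contra mS => /eqP <-.
have Ish : I (shift l m H) by move: (no l); rewrite lm /= negbK.
have US : shift_dir l m S by rewrite /shift_dir lS.
rewrite -swap_eltE //.
apply: (compress_potential (pot := pot) (@swap_eltK _ l m) _ _ SH US).
  move=> Z UZ; rewrite swap_eltE // /pot setU11 ltnS.
  by case/andP: UZ => _ /negPf ->.
by apply: maxH; rewrite Ish weight_shift.
Qed.

Definition valid (T : finType) (D : {set T}) (q : nat) (H : {set {set T}}) :=
  (H \subset powerset D) && union_bounded q H.

Lemma valid_add (T : finType) (D : {set T}) (q : nat) (H : {set {set T}})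
    (S S' : {set T}) :
  S \subset S' -> S' \in H -> valid D q H -> valid D q (S |: H).
Proof.
move=> sub S'H /andP[HD uH]; rewrite /valid (union_bounded_add sub S'H uH) andbT.
rewrite subUset HD andbT sub1set powersetE.
by apply: subset_trans sub _; rewrite -powersetE (subsetP HD).
Qed.

Lemma valid_shift (T : finType) (D : {set T}) (q : nat) (H : {set {set T}})
    (l m : T) :
  m \in D -> valid D q H -> valid D q (shift l m H).
Proof.
move=> mD /andP[/subsetP HD uH]; rewrite /valid union_bounded_shift // andbT.
apply/subsetP => S /compressP[[Z [ZH UZ ->]]|[/HD //]].
rewrite powersetE swap_eltE // subUset sub1set mD /=.
by apply: subset_trans (subsetDl _ _) _; rewrite -powersetE HD.
Qed.

(** Validity survives every shift towards [m], so [exists_stable] must return a shifted family, as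
    [reduce_coordinate] requires. *)
Lemma valid_reduce (R : realFieldType) (rho : R) (T : finType) (m : T)
    (D : {set T}) (H : {set {set T}}) (q t : nat) :
  1 <= rho -> m \in D -> #|D| = (q.+1 + t)%N -> valid D q.+1 H ->
  (forall s, q.+1 = (2 * s)%N -> t%:R - 1 <= s%:R * (rho - 1)) ->
  exists2 H' : {set {set T}}, valid (D :\ m) q H' &
    weight rho H <= (1 + rho) * weight rho H'.
Proof.
move=> rho1 mD Dc vH hs.
have [H1 [vH1 w1 dH1 sH1]] := exists_stable m (le_trans ler01 rho1) vH
  (fun H S S' => @valid_add T D q.+1 H S S').
have {}sH1 : shifted m H1.
  by case: sH1 => // -[l _]; rewrite valid_shift.
have HD1 : {in H1, forall S : {set T}, S \subset D}.
  by case/andP: vH1 => /subsetP HD _ S /HD; rewrite powersetE.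
have uH1 : union_bounded q.+1 H1 by case/andP: vH1.
have [H' [HD' uH' w' _]] := reduce_coordinate rho1 mD Dc HD1 dH1 sH1 uH1 hs.
exists H'; last exact: le_trans w1 w'.
by rewrite /valid uH' andbT; apply/subsetP => S /HD'; rewrite powersetE.
Qed.

(** The weight of a ball: all sets of at most [s] elements on [N] points. *)
Definition truncated_sum (R : realFieldType) (rho : R) (N s : nat) : R :=
  \sum_(j < s.+1) rho ^+ j *+ 'C(N, j).

(** A free extra point turns the ball on [N] points into the ball on [N.+1] points plus the sets of
    size [s.+1] through the new point. *)
Lemma truncated_sumS (R : realFieldType) (rho : R) (N s : nat) :
  (1 + rho) * truncated_sum rho N s =
  truncated_sum rho N.+1 s + rho ^+ s.+1 *+ 'C(N, s).
Proof.
rewrite /truncated_sum; elim: s => [|s IH].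
  by rewrite !big_ord_recl !big_ord0 !bin0 expr0 expr1; ring.
rewrite big_ord_recr /= mulrDr IH [in RHS]big_ord_recr /= binS.
rewrite mulrnDr [rho ^+ s.+2]exprS mulrnAr mulrDl mul1r.
rewrite !mulrnDl; ring.
Qed.

(* Going from [rho'] down to [rho] multiplies the weight of a set with at most
   [s] elements by at least [(rho / rho') ^+ s] and that of a larger set by at
   most this factor. *)
Lemma weight_truncated_le (R : realFieldType) (rho rho' : R) (T : finType)
    (D : {set T}) (H : {set {set T}}) (s : nat) :
  0 < rho -> rho <= rho' -> H \subset powerset D ->
  weight rho' H <= weight rho' [set S in powerset D | (#|S| <= s)%N] ->
  weight rho H <= weight rho [set S in powerset D | (#|S| <= s)%N].
Proof.
move=> rho0 le sub; set B := [set S in _ | _].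
have rho'0 : 0 < rho' by apply: lt_le_trans le.
have split (x : R) (X Y : {set {set T}}) :
    weight x X = weight x (X :&: Y) + weight x (X :\: Y).
  by rewrite /weight (big_setID Y).
rewrite !(split _ H B) !(split _ B H) [B :&: H]setIC !lerD2l => le'.
pose c := rho / rho'.
have c0 : 0 <= c by rewrite divr_ge0 ?ltW.
have c1 : c <= 1 by rewrite ler_pdivrMr ?mul1r.
have rhoE : rho = c * rho' by rewrite /c divfK ?gt_eqF.
have hi : weight rho (H :\: B) <= c ^+ s * weight rho' (H :\: B).
  rewrite /weight mulr_sumr; apply: ler_sum => S; rewrite !inE.
  case/andP=> nB SH; have := subsetP sub _ SH; rewrite powersetE => SD.
  rewrite SD /= -ltnNge in nB.
  rewrite rhoE exprMn; apply: ler_wpM2r; first by rewrite exprn_ge0 ?ltW.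
  by rewrite ler_wiXn2l // ltnW.
have lo : c ^+ s * weight rho' (B :\: H) <= weight rho (B :\: H).
  rewrite /weight mulr_sumr; apply: ler_sum => S; rewrite !inE.
  case/and3P=> _ _ Ss.
  rewrite rhoE [(c * rho') ^+ _]exprMn; apply: ler_wpM2r.
    by rewrite exprn_ge0 ?ltW.
  exact: ler_wiXn2l.
apply: le_trans hi _; apply: le_trans lo.
by rewrite ler_wpM2l ?exprn_ge0.
Qed.

(* Induction on [s]. By [weight_truncated_le] it is enough to treat the largest
   admissible [rho], where removing two coordinates is possible and the bounds
   for [s] and [s.+1] agree. *)
Lemma weight_le_truncated_sum (R : realFieldType) (T : finType) (s : nat) :
  forall (rho : R) (t : nat) (D : {set T}) (H : {set {set T}}),
  1 <= rho -> s%:R * (rho - 1) <= t%:R - 1 ->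
  #|D| = (2 * s + t)%N -> valid D (2 * s) H ->
  weight rho H <= truncated_sum rho (2 * s + t) s.
Proof.
elim: s => [|s IH] rho t D H rho1 hs Dc vH.
  rewrite /truncated_sum big_ord1 expr0 bin0 mulr1n.
  have -> : 1 = weight rho [set set0 : {set T}].
    by rewrite /weight big_set1 cards0 expr0.
  apply: weight_le; first exact: le_trans rho1.
  apply/subsetP => S SH; rewrite inE -cards_eq0 -leqn0.
  by have /andP[_ /union_boundedP/(_ S S SH SH)] := vH; rewrite setUid.
have q1 : (2 * s.+1)%N = (2 * s).+2 by rewrite mulnS.
have N1 : (2 * s.+1 + t = (2 * s + t).+2)%N by rewrite q1.
have [a aD] : exists a, a \in D by apply/card_gt0P; rewrite Dc N1.
have ca : #|D :\ a| = (2 * s + t).+1.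
  by move: Dc; rewrite N1 (cardsD1 a) aD => -[].
have [b bD] : exists b, b \in D :\ a by apply/card_gt0P; rewrite ca.
have cb : #|(D :\ a) :\ b| = (2 * s + t)%N.
  by move: ca; rewrite (cardsD1 b) bD => -[].
have s1 : 0 < s.+1%:R :> R by rewrite ltr0n.
(* The largest value that the hypothesis allows; equality there also gives the condition of
   [valid_reduce]. *)
pose rho' : R := 1 + (t%:R - 1) / s.+1%:R.
have rho'E : s.+1%:R * (rho' - 1) = t%:R - 1.
  by rewrite /rho' addrC addKr mulrC divfK ?gt_eqF.
have le : rho <= rho'.
  by rewrite -(lerD2r (-1)) -(ler_pM2l s1) rho'E.
have rho'1 : 1 <= rho' by apply: le_trans le.
rewrite /truncated_sum -Dc -weight_truncated.
apply: (weight_truncated_le (rho' := rho')) => //.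
- exact: lt_le_trans rho1.
- by case/andP: vH.
rewrite weight_truncated Dc -/(truncated_sum _ _ _).
rewrite q1 in vH.
have [||H1 v1 w1] := @valid_reduce R rho' T a D H (2 * s).+1 t rho'1 aD _ vH.
- by rewrite Dc N1.
- by move=> s' e; have -> : s' = s.+1; [clear -e; lia | rewrite rho'E].
(* This removal starts from the odd bound [(2 * s).+1], so its condition is vacuous. *)
have [||H2 v2 w2] := @valid_reduce R rho' T b (D :\ a) H1 (2 * s) t rho'1 bD _ v1.
- exact: ca.
- by move=> s' e; exfalso; clear -e; lia.
have hs2 : s%:R * (rho' - 1) <= t%:R - 1.
  rewrite -rho'E ler_wpM2r ?subr_ge0 //; by rewrite ler_nat.
have w3 := IH rho' t _ H2 rho'1 hs2 cb v2.
apply: le_trans w1 _.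
have p0 : 0 <= 1 + rho' by rewrite addr_ge0 // (le_trans ler01).
apply: le_trans (ler_wpM2l p0 w2) _.
apply: le_trans (ler_wpM2l p0 (ler_wpM2l p0 w3)) _.
rewrite truncated_sumS mulrDr truncated_sumS.
rewrite N1 [leRHS]/truncated_sum big_ord_recr /= -/(truncated_sum _ _ _).
rewrite !binS.
set N := (2 * s + t)%N.
(* By choice [s.+1%:R * rho'] is [s + t], and [N - s] is [s + t] too; so the surplus terms of
   [truncated_sumS] fit into level [s.+1] of the larger ball. *)
have key : rho' * 'C(N, s)%:R <= 'C(N, s.+1)%:R :> R.
  rewrite -(ler_pM2l s1).
  have -> : s.+1%:R * 'C(N, s.+1)%:R = (s + t)%N%:R * 'C(N, s)%:R :> R.
    by rewrite -!natrM mul_bin_left /N; congr (_ * _)%:R; clear; lia.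
  rewrite mulrA ler_wpM2r // natrD.
  move: rho'E; rewrite -natr1; lra.
have x0 : 0 <= rho' ^+ s.+1 by rewrite exprn_ge0 // (le_trans ler01).
have := ler_wpM2l x0 key.
have nE c : rho' ^+ s.+1 *+ c = rho' ^+ s.+1 * c%:R by rewrite mulr_natr.
rewrite !mulrnDr !nE.
set y := truncated_sum _ _ _; lra.
Qed.

(** * Non-trivial families of sets *)

(** [W], and below it [A], with a real [rho] in place of [n - 1]. *)
Definition W_weight (R : realFieldType) (rho : R) (q t : nat) : R :=
  (1 + rho) ^+ q - rho ^+ q + t%:R * rho.

Definition A_weight (R : realFieldType) (rho : R) (q t i : nat) : R :=
  (1 + rho) ^+ (q - 2 * i) * truncated_sum rho (2 * i + t) i.

Lemma A_weightS (R : realFieldType) (rho : R) (q t i : nat) :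
  (2 * i <= q)%N -> A_weight rho q.+1 t i = (1 + rho) * A_weight rho q t i.
Proof. by move=> iq; rewrite /A_weight subSn // exprS mulrA. Qed.

(** Induction on [q]: if [q = 2 * s] with [s%:R * (rho - 1) <= t%:R - 1], the ball is optimal;
    otherwise a coordinate can be removed, at the factor that [A_weightS] accounts for. *)
Lemma weight_le_A_weight (R : realFieldType) (rho : R) (T : finType)
    (q t : nat) :
  1 <= rho -> rho <= t%:R -> (1 < q)%N ->
  forall (D : {set T}) (H : {set {set T}}),
  #|D| = (q + t)%N -> valid D q H ->
  exists i, [/\ (0 < i)%N, (2 * i <= q)%N & weight rho H <= A_weight rho q t i].
Proof.
move=> rho1 rhot; elim: q => // q IH q1 D H Dc vH.
case: (boolP [exists s : 'I_q.+2, (q.+1 == 2 * s)%N &&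
    (s%:R * (rho - 1) <= t%:R - 1)]) => [/existsP[[s ss] /andP[/eqP /= qs hs]]|].
  clear ss.
  exists s; split; [by clear -qs; lia|by rewrite qs|].
  rewrite /A_weight qs subnn expr0 mul1r.
  by apply: (weight_le_truncated_sum (D := D) rho1 hs); rewrite -qs.
rewrite negb_exists => /forallP no.
have hs s : q.+1 = (2 * s)%N -> t%:R - 1 <= s%:R * (rho - 1).
  move=> e; have sq : (s < q.+2)%N by clear -e; lia.
  by move: (no (Ordinal sq)); rewrite /= -e eqxx /= -ltNge => /ltW.
(* At [q.+1 = 2] the first case applies with [s = 1] since [rho <= t]; so [i] never drops to 0. *)
have q2 : (1 < q)%N.
  move: q1; rewrite ltnS leq_eqVlt => /orP[/eqP e|//].
  rewrite -e in no.
  by move: (no (Ordinal (isT : 1 < 3)%N)) => /=; rewrite mul1r lerD2r rhot.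
have [m mD] : exists m, m \in D by apply/card_gt0P; rewrite Dc.
have [H' v' w'] := valid_reduce rho1 mD Dc vH hs.
have Dc' : #|D :\ m| = (q + t)%N by move: Dc; rewrite (cardsD1 m) mD => -[].
have [i [i0 iq wi]] := IH q2 _ _ Dc' v'.
exists i; split=> //; first exact: leqW.
rewrite A_weightS //; apply: le_trans w' _; apply: ler_wpM2l wi.
by rewrite addr_ge0 // (le_trans ler01).
Qed.

Lemma singleton_in_downset (T : finType) (H : {set {set T}}) (x : T) :
  downset H -> x \in cover H -> [set x] \in H.
Proof.
by move=> dH /bigcupP[S SH xS]; apply: dH SH; rewrite sub1set.
Qed.

Lemma cover_shift (T : finType) (l m : T) (H : {set {set T}}) :
  cover H :\ l \subset cover (shift l m H).
Proof.
apply/subsetP => x; rewrite !inE => /andP[xl /bigcupP[S SH xS]].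
apply/bigcupP; exists (compress_map (swap_elt l m) (shift_dir l m) H S).
  exact: imset_f.
rewrite /compress_map; case: ifP => // /andP[US _].
by rewrite swap_eltE // !inE xl xS orbT.
Qed.

(** The cover then has [q.+1] elements and no member contains both [l] and [m]. The members are [S],
    [m |: S] or [l |: S] with [S] inside a set [E] of [q - 1] elements, and [cross_weight_le] bounds
    the last two kinds jointly. *)
Lemma trivial_shift_weight_le (R : realFieldType) (rho : R) (T : finType)
    (l m : T) (H : {set {set T}}) (q t : nat) :
  1 <= rho -> (0 < t)%N -> l != m -> downset H -> union_bounded q H ->
  (q < #|cover H|)%N -> (#|cover (shift l m H)| <= q)%N ->
  weight rho H <= W_weight rho q t.
Proof.
move=> rho1 t0 lm dH /union_boundedP uH cH cS.
set C := cover H in cH.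
have subC := subset_leq_card (cover_shift l m H).
have lC : l \in C.
  apply/negPn/negP => nl; have := leq_trans subC cS.
  rewrite (setDidPl _); first by rewrite leqNgt cH.
  by rewrite disjoint_sym disjoints1.
have cC : #|C| = q.+1.
  have := leq_trans subC cS; rewrite -/C => le.
  by move: cH; rewrite (cardsD1 l C) lC; clear -le; lia.
have eC : cover (shift l m H) = C :\ l.
  apply/esym/eqP; rewrite eqEcard cover_shift /=.
  by move: cC; rewrite (cardsD1 l C) lC add1n => -[->].
(* A member containing both would not be moved and would keep [l] covered. *)
have noL S : S \in H -> l \in S -> m \notin S.
  move=> SH lS; apply/negP => mS.
  have : l \in cover (shift l m H).
    apply/bigcupP; exists S => //; apply/imsetP; exists S => //.
    by rewrite /compress_map /shift_dir mS andbF.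
  by rewrite eC !inE eqxx.
have mC : m \in C.
  suff : m \in cover (shift l m H) by rewrite eC inE => /andP[].
  case/bigcupP: (lC) => S SH lS; apply/bigcupP.
  have US : shift_dir l m S by rewrite /shift_dir lS noL.
  exists (swap_elt l m S); last by rewrite swap_eltE // setU11.
  apply/imsetP; exists S => //; rewrite /compress_map US /=.
  case: ifP => // /negbFE pH.
  have : l \in cover (shift l m H).
    apply/bigcupP; exists S => //; apply/imsetP; exists S => //.
    by rewrite /compress_map pH andbF.
  by rewrite eC !inE eqxx.
pose E := C :\ l :\ m.
have cE : #|E|.+1 = q.
  move: cC; rewrite (cardsD1 l C) lC (cardsD1 m (C :\ l)) !inE eq_sym lm mC.
  by case.
have inE' (S : {set T}) : S \subset C -> l \notin S -> m \notin S -> S \subset E.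
  by move=> SC lS mS; rewrite !subsetD1 SC lS.
have subH S : S \in H -> S \subset C by move=> SH; apply: bigcup_sup.
pose H0 := [set S in H | l \notin S].
have dH0 : downset H0.
  move=> S S' sub; rewrite !inE => /andP[S'H lS']; rewrite (dH _ _ sub S'H) /=.
  by apply: contra lS'; apply: (subsetP sub).
set P := stable_part m H0; set Q := stable_part l H.
have PE : {in P, forall S : {set T}, S \subset E}.
  by move=> S; rewrite !inE => /and3P[/andP[SH lS] mS _]; rewrite inE' ?subH.
have QE : {in Q, forall S : {set T}, S \subset E}.
  move=> S; rewrite !inE => /and3P[SH lS lSH]; rewrite inE' ?subH //.
  by have := noL _ lSH (setU11 _ _); rewrite !inE negb_or => /andP[].
have dP : downset P.
  move=> S S' sub; rewrite !inE => /and3P[/andP[S'H lS'] mS' /andP[mH lm']].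
  rewrite (dH _ _ sub S'H) (dH _ _ (setUS _ sub) mH) /=.
  have s x : x \in S -> x \in S' by apply: (subsetP sub).
  rewrite (contra (s l)) // (contra (s m)) //=.
  by apply: contra lm' => /orP[->//|/s->]; rewrite orbT.
have H00 : set0 \in H.
  by apply: dH (sub0set _) (singleton_in_downset dH lC).
have P0 : set0 \in P.
  by rewrite !inE H00 setU0 (singleton_in_downset dH mC) orbF lm.
have Q0 : set0 \in Q by rewrite !inE H00 setU0 (singleton_in_downset dH lC).
(* Otherwise the union of [m |: S] and [l |: S'] would be all of [C]. *)
have PQ : {in P & Q, forall S S' : {set T}, S :|: S' != E}.
  move=> S S'; rewrite !inE => /and3P[_ _ /andP[mSH _]] /and3P[_ _ lS'H].
  apply/eqP => e; have := uH _ _ mSH lS'H; rewrite leqNgt -cC => /negP[].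
  apply: subset_leq_card; apply/subsetP => x xC; rewrite !inE.
  case: (x =P m) => //= /eqP xm; case: (x =P l) => /= [|/eqP xl].
    by rewrite orbT.
  have : x \in E by rewrite !inE xm xl xC.
  by rewrite -e inE.
have := cross_weight_le rho1 dP P0 Q0 PE QE PQ.
rewrite (weight_split _ l dH) -/H0 (weight_split _ m dH0) -/P -/Q.
set N := [set _ in H0 | _].
have : weight rho N <= (1 + rho) ^+ #|E|.
  rewrite -weight_powerset; apply: weight_le; first exact: le_trans rho1.
  apply/subsetP => S; rewrite !inE => /andP[/andP[SH lS] mS].
  by rewrite inE' ?subH.
(* The bounds add up to [(1 + rho) ^+ q - rho ^+ q + rho], and [1 <= t]. *)
rewrite /W_weight -cE !exprS.
have t1 : 1 <= t%:R :> R by rewrite ler1n.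
move=> wN wPQ.
have rho0 : 0 <= rho by apply: le_trans rho1.
move: wN (ler_wpM2l rho0 wPQ) (ler_wpM2r rho0 t1).
move: (weight rho N) (weight rho P) (weight rho Q) ((1 + rho) ^+ #|E|) => n p q'.
by move: (rho ^+ #|E|); clear; move=> x y; lra.
Qed.

Lemma exists_subset_card (T : finType) (S D : {set T}) (p : nat) :
  S \subset D -> (#|S| <= p <= #|D|)%N ->
  exists Q : {set T}, [/\ S \subset Q, Q \subset D & #|Q| = p].
Proof.
move=> SD /andP[Sp pD].
have : (0 < #|[set B : {set T} | (B \subset D :\: S) & (#|B| == p - #|S|)%N]|)%N.
  by rewrite cards_draws bin_gt0 cardsD (setIidPr SD) leq_sub2r.
case/card_gt0P=> B; rewrite inE => /andP[BD /eqP Bc].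
exists (S :|: B); rewrite subsetUl subUset SD (subset_trans BD (subsetDl _ _)).
split=> //; rewrite cardsU Bc (_ : S :&: B = set0) ?cards0 ?subn0 ?subnKC //.
apply/eqP; rewrite setI_eq0 disjoint_sym disjoints_subset.
by apply: subset_trans BD _; rewrite setDE subsetIr.
Qed.

(** The supports in the extremal family for [W] when [#|Q| = q]: words vanishing outside [Q] with a
    further zero in [Q], and words with a single nonzero letter, outside [Q]. *)
Definition W_family (T : finType) (D Q : {set T}) : {set {set T}} :=
  (powerset Q :\ Q) :|: [set [set x] | x in D :\: Q].

Lemma weight_W_family (R : realFieldType) (rho : R) (T : finType)
    (D Q : {set T}) (q t : nat) :
  Q \subset D -> #|Q| = q -> #|D| = (q + t)%N ->
  weight rho (W_family D Q) = W_weight rho q t.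
Proof.
move=> QD Qc Dc.
rewrite /W_family weight_disjointU; last first.
  rewrite disjoint_sym disjoints_subset; apply/subsetP => _ /imsetP[x + ->].
  by rewrite !inE sub1set => /andP[/negPf -> _]; rewrite andbF.
have -> : weight rho (powerset Q :\ Q) = (1 + rho) ^+ q - rho ^+ q.
  rewrite -{1}Qc -weight_powerset /weight [in RHS](big_setD1 Q) /=.
    by rewrite Qc addrAC subrr add0r.
  by rewrite powersetE.
rewrite /W_weight; congr (_ + _); rewrite /weight big_imset /=;
  last by move=> x y _ _ /set1_inj.
rewrite (eq_bigr (fun _ => rho)) => [|x _]; last by rewrite cards1.
by rewrite sumr_const cardsD (setIidPr QD) Dc Qc addKn mulr_natl.
Qed.

(** The last hypothesis counts the coordinates that share a member with [m]. Being few, they fit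
    with [m] into a set [Q] of size [q], and the family lies in [W_family D Q]. *)
Lemma trivial_reduction_weight_le (R : realFieldType) (rho : R) (T : finType)
    (m : T) (D : {set T}) (H : {set {set T}}) (q t : nat) :
  0 <= rho -> m \in D -> #|D| = (q + t)%N -> valid D q H -> downset H ->
  shifted m H -> (q < #|cover H|)%N ->
  (#|[set l in D :\ m | [set l; m] \in H]| < q)%N ->
  weight rho H <= W_weight rho q t.
Proof.
move=> rho0 mD Dc /andP[/subsetP HD /union_boundedP uH] dH sH cH.
set L := [set l in _ | _] => Lq.
have HD' S : S \in H -> S \subset D by move/HD; rewrite powersetE.
have [Q [LQ QD Qc]] : exists Q : {set T},
    [/\ m |: L \subset Q, Q \subset D & #|Q| = q].
  apply: exists_subset_card; last first.
    rewrite Dc leq_addr andbT cardsU1; apply: leq_trans Lq.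
    by rewrite -[X in (_ <= X)%N]add1n leq_add2r leq_b1.
  rewrite subUset sub1set mD; apply/subsetP => l; rewrite !inE.
  by case/andP => /andP[].
(* Some covered point lies outside [Q]; with [Q] it would form a union of [q.+1] elements. *)
have QnH : Q \notin H.
  apply/negP => QH; have [x xC xQ] : exists2 x, x \in cover H & x \notin Q.
    apply/subsetPn; apply/negP => /subset_leq_card; rewrite Qc.
    by rewrite leqNgt cH.
  have := uH _ _ (singleton_in_downset dH xC) QH.
  by rewrite cardsU1 xQ Qc ltnn.
have mLE S l : S \in H -> l \in S -> m \in S -> l \in m |: L.
  move=> SH lS mS; rewrite !inE; case: (l =P m) => //= _.
  rewrite (subsetP (HD' _ SH)) //=; apply: dH SH.
  by rewrite subUset !sub1set lS.
have sub : H \subset W_family D Q.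
  apply/subsetP => S SH; rewrite !inE.
  have -> /= : S != Q by apply: contraNneq QnH => <-.
  case: (boolP (S \subset Q)) => //= SQ.
  have mS : m \notin S.
    apply: contra SQ => mS; apply: subset_trans LQ; apply/subsetP => l lS.
    exact: mLE SH lS mS.
  have /subsetPn[x xS xQ] := SQ.
  suff -> : S = [set x].
    by apply: imset_f; rewrite inE xQ (subsetP (HD' _ SH)).
  apply/eqP; rewrite eq_sym eqEsubset sub1set xS /=.
  apply/subsetP => y yS; rewrite inE; apply/negPn/negP => yx.
  (* Shifting a second element [y] to [m] gives a member through [x] and [m], which would force [x]
     into [Q]. *)
  have := sH _ _ SH yS mS => S'H.
  have : x \in m |: L.
    by apply: mLE S'H _ (setU11 _ _); rewrite !inE (eq_sym x y) yx xS orbT.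
  by move/(subsetP LQ); rewrite (negPf xQ).
by rewrite -(weight_W_family rho QD Qc Dc); apply: weight_le.
Qed.

(** The two sides differ by [rho ^+ q - t%:R * rho ^+ 2]. *)
Lemma W_weightS (R : realFieldType) (rho : R) (q t : nat) :
  1 <= rho -> t%:R <= rho -> (2 < q)%N ->
  (1 + rho) * W_weight rho q t <= W_weight rho q.+1 t.
Proof.
move=> rho1 trho; case: q => [|[|[|q]]] // _.
rewrite /W_weight !exprS.
have rho0 : 0 <= rho by apply: le_trans rho1.
have x1 : 1 <= rho ^+ q by apply: exprn_ege1.
have := ler_wpM2l rho0 (ler_wpM2l rho0 trho).
have := ler_wpM2l rho0 (ler_wpM2l rho0 (ler_wpM2l rho0 x1)).
set x := rho ^+ q; set y := (1 + rho) ^+ q.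
lra.
Qed.

(** Both are [1 + (t + 2) rho]. This lets the induction below switch from [W] to [A] at [q = 2],
    where [W_weightS] does not apply. *)
Lemma W_weight2 (R : realFieldType) (rho : R) (t : nat) :
  W_weight rho 2 t = A_weight rho 2 t 1.
Proof.
rewrite /W_weight /A_weight /truncated_sum !big_ord_recr big_ord0 /=.
rewrite bin0 bin1 expr0 expr1 mulr1n mulrnDr -(mulr_natr rho t) ; ring.
Qed.

(** Induction on [q] with three cases: a shift makes the family trivial, removing [m] could make it
    trivial, or [m] can be removed. Non-triviality excludes [q <= 1], so [1 < q] in the conclusion
    takes the place of a base case. *)
Lemma nontrivial_weight_le (R : realFieldType) (rho : R) (T : finType)
    (t : nat) :
  (0 < t)%N -> t.+1%:R <= rho ->
  forall (q : nat) (D : {set T}) (H : {set {set T}}),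
  #|D| = (q + t)%N -> valid D q H -> (q < #|cover H|)%N ->
  (1 < q)%N /\
  (weight rho H <= W_weight rho q t \/ weight rho H <= A_weight rho q t 1).
Proof.
move=> t0 trho; have t1 : 1 <= t%:R :> R by rewrite ler1n.
have trho' : t%:R <= rho by apply: le_trans trho; rewrite ler_nat.
have rho1 : 1 <= rho by apply: le_trans trho'.
have rho0 : 0 <= rho by apply: le_trans rho1.
elim=> [|q IH] D H Dc vH cH.
  have [x /bigcupP[S SH xS]] : exists x, x \in cover H by apply/card_gt0P.
  have /andP[_ /union_boundedP/(_ S S SH SH)] := vH.
  by rewrite setUid leqn0 cards_eq0 => /eqP S0; rewrite S0 inE in xS.
have q1 : (0 < q)%N.
  rewrite lt0n; apply/negP => /eqP q0; rewrite q0 in vH cH.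
  case/card_gt1P: cH => x [y [/bigcupP[S SH xS] /bigcupP[S' S'H yS'] xy]].
  have /andP[_ /union_boundedP/(_ S S' SH S'H) le] := vH.
  have sub : [set x; y] \subset S :|: S'.
    by rewrite subUset !sub1set !inE xS yS' orbT.
  by have := leq_trans (subset_leq_card sub) le; rewrite cards2 xy.
split=> //.
have [m mD] : exists m, m \in D by apply/card_gt0P; rewrite Dc.
pose I (H : {set {set T}}) := valid D q.+1 H && (q.+1 < #|cover H|)%N.
have IH0 : I H by rewrite /I vH.
have Iadd (H' : {set {set T}}) (S S' : {set T}) :
    S \subset S' -> S' \in H' -> I H' -> I (S |: H').
  move=> sub S'H /andP[v c]; rewrite /I (valid_add sub S'H v) /=.
  apply: leq_trans c _; apply: subset_leq_card; apply/bigcupsP => Z ZH.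
  by apply: bigcup_sup; rewrite setU1r.
have [{IH0}H1 [/andP[v1 c1] w1 d1 s1]] := exists_stable m rho0 IH0 Iadd.
suff : weight rho H1 <= W_weight rho q.+1 t \/
    weight rho H1 <= A_weight rho q.+1 t 1.
  by case=> h; [left|right]; apply: le_trans w1 h.
have u1 : union_bounded q.+1 H1 by case/andP: v1.
case: s1 => [[l lm]|s1].
  rewrite /I valid_shift //= -leqNgt => triv; left.
  exact: trivial_shift_weight_le lm d1 u1 c1 triv.
case: (ltnP #|[set l in D :\ m | [set l; m] \in H1]| q.+1) => [small|big].
  by left; apply: trivial_reduction_weight_le mD Dc v1 d1 s1 c1 small.
have HD1 : {in H1, forall S : {set T}, S \subset D}.
  by case/andP: v1 => /subsetP HD _ S /HD; rewrite powersetE.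
(* For [t <= rho] the averaging condition holds for all [s >= 1]. *)
have hs s : q.+1 = (2 * s)%N -> t%:R - 1 <= s%:R * (rho - 1).
  move=> e; have s0 : 1 <= s%:R :> R by rewrite ler1n; clear -e; lia.
  have : 0 <= rho - 1 by rewrite subr_ge0.
  by move/(ler_wpM2r) => /(_ _ _ s0); move: trho'; lra.
have [H' [HD' u' w' sub']] := reduce_coordinate rho1 mD Dc HD1 d1 s1 u1 hs.
have v' : valid (D :\ m) q H'.
  by rewrite /valid u' andbT; apply/subsetP => S /HD'; rewrite powersetE.
have Dc' : #|D :\ m| = (q + t)%N by move: Dc; rewrite (cardsD1 m) mD => -[].
(* If [[set l; m]] is in [H1], then [[set l]] is stable and therefore kept. *)
have c' : (q < #|cover H'|)%N.
  apply: leq_trans big _; apply: subset_leq_card; apply/subsetP => l.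
  rewrite !inE => /andP[/andP[lm _] lmH]; apply/bigcupP; exists [set l].
    apply: (subsetP sub'); rewrite !inE eq_sym lm setUC lmH andbT /=.
    by rewrite andbT; apply: d1 lmH; rewrite subsetUl.
  by rewrite inE.
have p0 : 0 <= 1 + rho by rewrite addr_ge0.
have [q2 [wW|wA]] := IH _ _ Dc' v' c'.
  have w2 := le_trans w' (ler_wpM2l p0 wW).
  move: q2 w2; rewrite leq_eqVlt => /orP[/eqP <-|q2] w2.
    by right; rewrite A_weightS // -W_weight2.
  by left; apply: le_trans w2 _; apply: W_weightS.
by right; rewrite A_weightS //; apply: le_trans w' (ler_wpM2l p0 wA).
Qed.

(** * From words to sets and back *)

Lemma t_intersectingP (n r t : nat) (F : {set word n r}) :
  reflect {in F &, forall x y : word n r, (t <= #|agr x y|)%N}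
    (t_intersecting t F).
Proof.
apply: (iffP forall_inP) => [h x y xF yF|h x xF].
  by have /forall_inP := h x xF; apply.
by apply/forall_inP => y yF; apply: h.
Qed.

Lemma fixed_coordsP (n r : nat) (F : {set word n r}) i :
  reflect {in F &, forall x y : word n r, x i = y i} (i \in fixed_coords F).
Proof.
rewrite inE; apply: (iffP forall_inP) => [h x y xF yF|h x xF].
  by have /forall_inP := h x xF => /(_ y yF)/eqP.
by apply/forall_inP => y yF; apply/eqP/h.
Qed.

Lemma t_intersecting_compress (k r t : nat) (F : {set word k.+1 r})
    (i : 'I_r) (a : 'I_k.+1) :
  a != ord0 -> t_intersecting t F ->
  t_intersecting t (compress (swap_letter i a) (fun x => x i == a) F).
Proof.
move=> a0 /t_intersectingP tF; apply/t_intersectingP.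
apply: (compress_rel (e := fun x y : word k.+1 r => (t <= #|agr x y|)%N)) => //.
- exact: swap_letterK.
- move=> x y; congr (_ <= _)%N; apply: eq_card => j.
  by rewrite !inE eq_sym.
- move=> x y; congr (_ <= _)%N; apply: eq_card => j.
  by rewrite !inE swap_letter_eq.
- by move=> y; apply: swap_letter_fix.
move=> x y /eqP xi /eqP yi /leq_trans; apply; apply: subset_leq_card.
apply/subsetP => j; rewrite !inE => /eqP xy; apply/eqP.
exact: swap_letter_agree.
Qed.

(** Words with different letters in [i] agree in only [t - 1] places of [Z], hence somewhere outside
    [Z]. Restriction to the [q] coordinates outside [Z] is injective on each class, so
    [cross_agreeing_card] applies. *)
Lemma two_letter_card (k r q : nat) (F : {set word k.+1 r}) (Z : {set 'I_r})
    (i : 'I_r) (a b : 'I_k.+1) (t : nat) :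
  (0 < k)%N -> t_intersecting t F -> i \in Z -> #|Z| = t ->
  r = (q + t)%N -> Z :\ i \subset fixed_coords F -> a != b ->
  {in F, forall x : word k.+1 r, x i = a \/ x i = b} ->
  (exists2 x, x \in F & x i = a) -> (exists2 x, x \in F & x i = b) ->
  (#|F| + k ^ q <= k.+1 ^ q + 1)%N.
Proof.
move=> k0 /t_intersectingP tF iZ Zt rE /subsetP ZF ab Fab [x0 x0F x0a] [y0 y0F y0b].
pose T : finType := {j : 'I_r | j \notin Z}.
have cT : #|T| = q.
  have := cardsC Z; rewrite card_ord Zt [X in _ = X]rE addnC => /addIn <-.
  by rewrite card_sig; apply: eq_card => j; rewrite !inE.
pose res (x : word k.+1 r) : {ffun T -> 'I_k.+1} := [ffun j => x (val j)].
pose G c := [set x in F | x i == c].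
have res_inj c : {in G c &, injective res}.
  move=> x y; rewrite !inE => /andP[xF /eqP xc] /andP[yF /eqP yc] e.
  apply/ffunP => j; case: (boolP (j \in Z)) => jZ.
    case: (j =P i) => [->|/eqP ji]; first by rewrite xc yc.
    by apply: (fixed_coordsP _ _ (ZF j _)); rewrite // !inE ji.
  have := congr1 (fun f : {ffun T -> 'I_k.+1} => f (Sub j jZ)) e.
  by rewrite !ffunE.
have cF : (#|F| <= #|res @: G a| + #|res @: G b|)%N.
  rewrite !card_in_imset //; apply: leq_trans (leq_card_setU _ _).
  apply: subset_leq_card; apply/subsetP => x xF; rewrite !inE xF /=.
  by case: (Fab x xF) => ->; rewrite eqxx ?orbT.
have cross : {in res @: G a & res @: G b,
    forall x y : {ffun T -> 'I_k.+1}, [exists j, x j == y j]}.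
  move=> _ _ /imsetP[x + ->] /imsetP[y + ->].
  rewrite !inE => /andP[xF /eqP xa] /andP[yF /eqP yb].
  apply: contraT => /existsPn no.
  have := tF _ _ xF yF; rewrite leqNgt => /negP[].
  rewrite -Zt [X in (_ < X)%N](cardsD1 i) iZ add1n ltnS; apply: subset_leq_card.
  apply/subsetP => j; rewrite !inE => xy; apply/andP; split.
    by apply: contraTneq xy => ->; rewrite xa yb.
  apply/negPn/negP => jZ; have := no (Sub j jZ : T).
  by rewrite !ffunE /= xy.
have Pn : res @: G a != set0.
  by apply/set0Pn; exists (res x0); apply: imset_f; rewrite inE x0F x0a eqxx.
have Qn : res @: G b != set0.
  by apply/set0Pn; exists (res y0); apply: imset_f; rewrite inE y0F y0b eqxx.
have := cross_agreeing_card k0 Pn Qn cross; rewrite cT.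
by apply: leq_trans; rewrite leq_add2r.
Qed.

(** Compression in [i] can only make [i] newly fixed. So [i] becomes constantly zero, [t - 1] other
    coordinates were fixed before, and [F] uses just the letters 0 and [x i] in [i]: the case of
    [two_letter_card]. *)
Lemma trivial_compress_card (k r q t : nat) (F : {set word k.+1 r})
    (i : 'I_r) (x : word k.+1 r) :
  (0 < k)%N -> r = (q + t)%N -> t_intersecting t F ->
  nontrivial t F -> x \in F -> x i != ord0 ->
  swap_letter i (x i) x \notin F ->
  ~~ nontrivial t (compress (swap_letter i (x i)) (fun y => y i == x i) F) ->
  (#|F| + k ^ q <= k.+1 ^ q + 1)%N.
Proof.
move=> k0 rE tF nF xF xi nx; rewrite /nontrivial -leqNgt => triv.
set a := x i in xi nx triv *; set U := fun y : word k.+1 r => y i == a in triv *.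
set C := compress _ _ _ in triv.
pose mv := compress_map (swap_letter i a) U F.
have mvC y : y \in F -> mv y \in C by move=> yF; apply: imset_f.
have mvj y j : j != i -> mv y j = y j.
  by move=> ji; rewrite /mv /compress_map; case: ifP; rewrite // ffunE (negPf ji).
have sub : fixed_coords C :\ i \subset fixed_coords F.
  apply/subsetP => j; rewrite in_setD1 => /andP[ji /fixed_coordsP fj].
  apply/fixed_coordsP => y z yF zF.
  by rewrite -(mvj y j ji) -(mvj z j ji); apply: fj; apply: mvC.
have iC : i \in fixed_coords C.
  apply/negPn/negP => ni.
  have sub' : fixed_coords C \subset fixed_coords F.
    apply: subset_trans sub; apply/subsetP => j jC; rewrite in_setD1 jC andbT.
    by apply: contraNneq ni => <-.
  have := leq_trans triv (subset_leq_card sub').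
  by rewrite leqNgt => /negP[]; exact: nF.
have Cc : #|fixed_coords C| = t.
  apply/eqP; rewrite eqn_leq triv andbT (cardsD1 i) iC add1n.
  exact: leq_ltn_trans (subset_leq_card sub) nF.
have mvx : mv x i = ord0.
  by rewrite /mv /compress_map /U eqxx nx /= ffunE eqxx tpermR.
have mv0 y : y \in F -> mv y i = ord0.
  by move=> yF; rewrite -mvx; apply: (fixed_coordsP _ _ iC); apply: mvC.
have Fab y : y \in F -> y i = ord0 \/ y i = a.
  move=> yF; have := mv0 y yF; rewrite /mv /compress_map.
  by case: ifP => [/andP[/eqP]|]; [right|left].
(* If [a] were the only letter in [i], then [F] would already have [t] fixed coordinates. *)
have y0 : exists2 y, y \in F & y i = ord0.
  case: (boolP [exists y in F, y i == ord0]) => [/exists_inP[y yF /eqP]|no].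
    by exists y.
  exfalso.
  have iF : i \in fixed_coords F.
    have all_a y : y \in F -> y i = a.
      move=> yF; case: (Fab y yF) => // e; case/negP: no.
      by apply/exists_inP; exists y; rewrite // e.
    by apply/fixed_coordsP => y z yF zF; rewrite !all_a.
  have : (t <= #|fixed_coords F|)%N.
    rewrite -Cc; apply: subset_leq_card; apply/subsetP => j jC.
    case: (j =P i) => [->//|/eqP ji].
    by apply: (subsetP sub); rewrite in_setD1 ji.
  by rewrite leqNgt => /negP[]; exact: nF.
apply: (two_letter_card k0 tF iC Cc rE sub _ Fab y0).
  by rewrite eq_sym.
by exists x.
Qed.

(** Among non-trivial families of this size take one with the most zeros. Either it is closed under
    zeroing and its supports form [H], or some compression would make it trivial, and
    [trivial_compress_card] gives the bound [W]. *)
Lemma card_le_weight_or_W (R : realFieldType) (k r q t : nat)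
    (F : {set word k.+1 r}) :
  (0 < k)%N -> (0 < t)%N -> r = (q + t)%N -> t_intersecting t F ->
  nontrivial t F ->
  #|F|%:R <= W_weight (k%:R : R) q t \/
  exists H : {set {set 'I_r}},
    [/\ valid [set: 'I_r] q H, (q < #|cover H|)%N &
        #|F|%:R <= weight (k%:R : R) H].
Proof.
move=> k0 t0 rE tF nF.
pose I (G : {set word k.+1 r}) :=
  [&& t_intersecting t G, nontrivial t G & #|G| == #|F|].
pose pot (x : word k.+1 r) := #|~: nonzero x|.
have IF : I F by rewrite /I tF nF eqxx.
case: (arg_maxnP (fun G : {set word k.+1 r} => \sum_(x in G) pot x)%N IF).
move=> G /and3P[tG nG /eqP cG] maxG; rewrite -cG.
case: (boolP [exists x in G, [exists i, (x i != ord0) &&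
    (zero_out [set i] x \notin G)]]).
  case/exists_inP=> x xG /existsP[i /andP[xi nx]]; left.
  rewrite -swap_letter_zero in nx.
  have triv : ~~ nontrivial t
      (compress (swap_letter i (x i)) (fun y => y i == x i) G).
    apply: contra nx => nC.
    apply: (compress_potential (U := fun y : word k.+1 r => y i == x i)
      (pot := pot) (@swap_letterK _ _ i (x i))) => //.
      move=> y /eqP yi; rewrite -yi swap_letter_zero /pot.
      by apply: card_nonzero_zero_out; rewrite yi.
    apply: maxG; rewrite /I t_intersecting_compress // nC /= card_compress ?cG //.
    exact: swap_letterK.
  have := trivial_compress_card k0 rE tG nG xG xi nx triv.
  rewrite -(ler_nat R) !natrD !natrX /W_weight -[k.+1%:R]natr1 [k%:R + 1]addrC.
  have tk : 1 <= t%:R * k%:R :> R by rewrite -natrM ler1n muln_gt0 t0.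
  move: tk; move: (_ * _) (#|G|%:R) (_ ^+ q) (_ ^+ q) => a b c d; lra.
rewrite negb_exists_in => /forall_inP no; right.
have cl S x : x \in G -> zero_out S x \in G.
  apply: zero_out_closed => {S}{}x i xG xi.
  have := no x xG; rewrite negb_exists => /forallP/(_ i).
  by rewrite xi /= negbK.
exists (@nonzero _ k @: G); split; last exact: card_le_weight.
  apply/andP; split; first by apply/subsetP => S _; rewrite powersetE subsetT.
  apply/union_boundedP => _ _ /imsetP[x xG ->] /imsetP[y yG ->].
  (* Zeroing [x] on the support of [y] leaves agreement at common zeros only, so at least [t]
     coordinates lie outside both supports. *)
  have := t_intersectingP _ _ tG _ _ (cl (nonzero y) x xG) yG.
  have sub : agr (zero_out (nonzero y) x) y \subset ~: (nonzero x :|: nonzero y).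
    apply/subsetP => j; rewrite !inE ffunE inE negb_or !negbK.
    by case: (y j =P ord0) => /= [->|/eqP yj]; rewrite ?andbT // eq_sym (negPf yj).
  move/leq_trans/(_ (subset_leq_card sub)) => le.
  have := cardsC (nonzero x :|: nonzero y); rewrite card_ord [X in _ = X]rE => e.
  by rewrite -(leq_add2r t) -e leq_add2l.
have sub : ~: fixed_coords G \subset cover (@nonzero _ k @: G).
  apply/subsetP => i; rewrite inE; apply: contraR => ni.
  have z x : x \in G -> x i = ord0.
    move=> xG; apply/eqP; apply: contraR ni => xi; apply/bigcupP.
    by exists (nonzero x); [apply: imset_f|rewrite inE].
  by apply/fixed_coordsP => x y xG yG; rewrite !z.
apply: leq_trans (subset_leq_card sub).
have := cardsC (fixed_coords G); rewrite card_ord [X in _ = X]rE => e.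
by rewrite -(ltn_add2l #|fixed_coords G|) e addnC ltn_add2l.
Qed.

(** * Families attaining the bounds *)

(** Take all words with support in [H]. Two of them agree at their common zeros, and since the zero
    word is among them, no covered coordinate is fixed. *)
Lemma le_iota0 (R : realFieldType) (k r q t : nat) (H : {set {set 'I_r}}) :
  (0 < k)%N -> r = (q + t)%N -> valid [set: 'I_r] q H -> set0 \in H ->
  (q < #|cover H|)%N -> weight (k%:R : R) H <= (iota0 t k.+1 r)%:R.
Proof.
move=> k0 rE /andP[_ /union_boundedP uH] H0 cH.
rewrite -card_nonzero_in ler_nat.
set F := [set x | _].
apply: (leq_bigmax_cond (F := fun F : {set word k.+1 r} => #|F|)).
apply/andP; split.
  apply/t_intersectingP => x y; rewrite !inE => xH yH.
  have sub : ~: (nonzero x :|: nonzero y) \subset agr x y.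
    by apply/subsetP => j; rewrite !inE negb_or !negbK => /andP[/eqP-> /eqP->].
  apply: leq_trans (subset_leq_card sub).
  have := cardsC (nonzero x :|: nonzero y); rewrite card_ord [X in _ = X]rE => e.
  by rewrite -(leq_add2l q) -e leq_add2r uH.
have sub : fixed_coords F \subset ~: cover H.
  apply/subsetP => i /fixed_coordsP fi; rewrite inE; apply/negP.
  case/bigcupP=> S SH iS.
  pose x : word k.+1 r := [ffun j => if j \in S then inord 1 else ord0].
  have o1 : (inord 1 : 'I_k.+1) != ord0 by rewrite -val_eqE /= inordK.
  have xS : nonzero x = S.
    by apply/setP => j; rewrite inE ffunE; case: ifP; rewrite ?o1 ?eqxx.
  have z0 : nonzero ([ffun => ord0] : word k.+1 r) = set0.
    by apply/setP => j; rewrite !inE ffunE eqxx.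
  have := fi x [ffun => ord0]; rewrite !inE xS z0 SH H0 => /(_ isT isT).
  by rewrite !ffunE iS => e; rewrite e eqxx in o1.
rewrite /nontrivial; apply: leq_ltn_trans (subset_leq_card sub) _.
have := cardsC (cover H); rewrite card_ord [X in _ = X]rE => e.
by rewrite -(ltn_add2l #|cover H|) e ltn_add2r.
Qed.

Lemma W_le_iota0 (R : realFieldType) (k r q t : nat) :
  (0 < k)%N -> (0 < t)%N -> (1 < q)%N -> r = (q + t)%N ->
  W_weight (k%:R : R) q t <= (iota0 t k.+1 r)%:R.
Proof.
move=> k0 t0 q1 rE.
have Dc : #|[set: 'I_r]| = (q + t)%N by rewrite cardsT card_ord.
have [|Q [_ QD Qc]] := @exists_subset_card _ set0 [set: 'I_r] q (sub0set _).
  by rewrite cards0 Dc leq_addr.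
rewrite -(weight_W_family _ QD Qc Dc); apply: (@le_iota0 R k r q t _ k0 rE).
- apply/andP; split; first by apply/subsetP => S _; rewrite powersetE subsetT.
  apply/union_boundedP => S S'; rewrite !inE.
  have half (B B' : {set 'I_r}) : (B != Q) && (B \subset Q) ->
      B' \in [set [set x] | x in [set: 'I_r] :\: Q] -> (#|B :|: B'| <= q)%N.
    move=> BQ /imsetP[x _ ->]; rewrite setUC cardsU1 -Qc.
    have : (#|B| < #|Q|)%N by apply: proper_card; rewrite properEneq.
    move=> lt; apply: leq_trans lt.
    by rewrite -[X in (_ <= X)%N]add1n leq_add2r leq_b1.
  case/orP=> [SQ|Sx] /orP[S'Q|S'x].
  - rewrite -Qc; apply: subset_leq_card; rewrite subUset.
    by case/andP: SQ => _ ->; case/andP: S'Q.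
  - exact: half.
  - by rewrite setUC half.
  case/imsetP: Sx => x _ ->; case/imsetP: S'x => y _ ->.
  by apply: leq_trans q1; rewrite cards2; case: (_ == _).
- rewrite !inE sub0set andbT; apply/orP; left.
  by rewrite eq_sym -cards_eq0 Qc -lt0n ltnW.
have -> : cover (W_family [set: 'I_r] Q) = [set: 'I_r].
  apply/setP => x; rewrite inE; apply/bigcupP; exists [set x]; last by rewrite inE.
  rewrite !inE sub1set; case: (boolP (x \in Q)) => xQ; last first.
    by apply/orP; right; apply: imset_f; rewrite !inE xQ.
  apply/orP; left; rewrite andbT; apply: contraTneq q1 => e.
  by rewrite -Qc -e cards1.
by rewrite Dc -addn1 leq_add2l.
Qed.

(** A set is the pair of its traces on [J] and on the complement; the second is free. *)
Lemma weight_product (R : realFieldType) (rho : R) (T : finType) (J : {set T})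
    (H : {set {set T}}) :
  H \subset powerset J ->
  weight rho [set S | S :&: J \in H] =
  weight rho (powerset (~: J)) * weight rho H.
Proof.
move=> /subsetP HJ; rewrite /weight mulrC big_distrlr /= pair_big /=.
rewrite (reindex_onto (fun p : {set T} * {set T} => p.1 :|: p.2)
  (fun S => (S :&: J, S :\: J))) /=; last by move=> S _; rewrite setID.
have dec (A B : {set T}) : A \subset J -> B \subset ~: J ->
    (A :|: B) :&: J = A /\ (A :|: B) :\: J = B.
  move=> AJ BJ; split.
    rewrite setIUl (setIidPl AJ) [B :&: J](_ : _ = set0) ?setU0 //.
    by apply/eqP; rewrite setI_eq0 disjoints_subset.
  rewrite setDUl setDE [A :&: _](_ : _ = set0) ?set0U ?setDE ?(setIidPl BJ) //.
  by apply/eqP; rewrite setI_eq0 disjoints_subset setCK.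
apply: eq_big => [[A B]|[A B]] /=.
  rewrite !inE xpair_eqE; apply/idP/idP.
    case/andP=> AH /andP[/eqP A' /eqP B'].
    by rewrite -A' AH /= -B' setDE subsetIr.
  case/andP=> AH BJ; have AJ := HJ _ AH; rewrite powersetE in AJ.
  by have [-> ->] := dec A B AJ BJ; rewrite AH !eqxx.
rewrite inE => /andP[_]; rewrite xpair_eqE => /andP[/eqP A' /eqP B'].
rewrite -exprD cardsU (_ : A :&: B = set0) ?cards0 ?subn0 //.
apply/eqP; rewrite setI_eq0 disjoints_subset -A' -B'.
by apply/subsetP => j; rewrite !inE => /andP[_ ->].
Qed.

(** Take the sets meeting a fixed [J] of [2 * i + t] points in at most [i] points: a union has at
    most [2 * i] elements in [J] and [q - 2 * i] outside. *)
Lemma A_le_iota0 (R : realFieldType) (k r q t i : nat) :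
  (0 < k)%N -> (0 < t)%N -> (0 < i)%N -> (2 * i <= q)%N -> r = (q + t)%N ->
  A_weight (k%:R : R) q t i <= (iota0 t k.+1 r)%:R.
Proof.
move=> k0 t0 i0 iq rE.
have Dc : #|[set: 'I_r]| = (q + t)%N by rewrite cardsT card_ord.
have [|J [_ JD Jc]] := @exists_subset_card _ set0 [set: 'I_r] (2 * i + t)
  (sub0set _).
  by rewrite cards0 Dc leq_add2r.
have JCc : #|~: J| = (q - 2 * i)%N.
  by have := cardsC J; rewrite card_ord [X in _ = X]rE Jc; clear -iq; lia.
pose H := [set S in powerset J | (#|S| <= i)%N].
have HJ : H \subset powerset J by apply/subsetP => S; rewrite inE => /andP[].
rewrite /A_weight /truncated_sum -Jc -weight_truncated -JCc -weight_powerset -/H.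
rewrite -weight_product //.
have inH S : (S \in [set S | S :&: J \in H]) = (#|S :&: J| <= i)%N.
  by rewrite !inE subsetIr.
apply: (@le_iota0 R k r q t _ k0 rE).
- apply/andP; split; first by apply/subsetP => S _; rewrite powersetE subsetT.
  apply/union_boundedP => S S'; rewrite !inH => Si S'i.
  rewrite -(cardsID J) setIUl.
  have h1 : (#|S :&: J :|: S' :&: J| <= 2 * i)%N.
    apply: leq_trans (leq_card_setU _ _) _.
    by rewrite mul2n -addnn leq_add.
  have h2 : (#|(S :|: S') :\: J| <= q - 2 * i)%N.
    by rewrite -JCc; apply: subset_leq_card; rewrite setDE subsetIr.
  by rewrite -(subnKC iq) leq_add.
- by rewrite inH set0I cards0.
suff -> : cover [set S | S :&: J \in H] = [set: 'I_r].
  by rewrite Dc -addn1 leq_add2l.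
apply/setP => x; rewrite inE; apply/bigcupP; exists [set x]; last by rewrite inE.
rewrite inH; apply: leq_trans i0; rewrite -(cards1 x); apply: subset_leq_card.
exact: subsetIl.
Qed.

(** * The formula for the maximum *)

Lemma W_weightE (R : realFieldType) (k q t : nat) :
  (W (q + t) t k.+1)%:R = W_weight (k%:R : R) q t.
Proof.
rewrite /W addnK subn1 /= natrD natrB;
  last by case: q => // q; rewrite leq_exp2r.
by rewrite natrM !natrX /W_weight -natr1 [k%:R + 1]addrC.
Qed.

Lemma A_weightE (R : realFieldType) (k q t i : nat) :
  (A i t k.+1 (q + t))%:R = A_weight (k%:R : R) q t i.
Proof.
rewrite /A addnK subn1 /= natrM natrX /A_weight -natr1 [k%:R + 1]addrC.
congr (_ * _); rewrite natr_sum big_mkord /truncated_sum.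
by apply: eq_bigr => j _; rewrite natrM natrX addnC mulrC mulr_natr.
Qed.

Local Close Scope ring_scope.

Theorem theorem1p1 (r t n : nat) (hr : 3 <= r) (ht1 : 1 <= t)
    (ht2 : t <= r - 2) (hn : 2 <= n) :
  iota0 t n r =
    maxn (W r t n) (\max_(1 <= i < ((r - t) %/ 2).+1) A i t n r).
Proof.
case: n hn => [|k] // k0; rewrite ltnS in k0.
have [q rE] : exists q, r = (q + t)%N.
  by exists (r - t)%N; rewrite subnK //; lia.
have q1 : (1 < q)%N by lia.
have qE : (r - t = q)%N by rewrite rE addnK.
have i_range i : ((0 < i) && (i < (q %/ 2).+1) = (0 < i) && (2 * i <= q))%N.
  by rewrite ltnS leq_divRL // mulnC.
apply/eqP; rewrite eqn_leq qE; apply/andP; split; last first.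
  rewrite geq_max -(ler_nat rat) rE W_weightE W_le_iota0 //=.
  apply/bigmax_leqP_seq => i; rewrite mem_index_iota i_range => /andP[i0 iq] _.
  by rewrite -(ler_nat rat) A_weightE A_le_iota0.
apply/bigmax_leqP => F /andP[tF nF].
have Wle x : (x%:R <= W_weight (k%:R : rat) q t)%R ->
    (x <= maxn (W r t k.+1) (\max_(1 <= i < (q %/ 2).+1) A i t k.+1 r))%N.
  by move=> h; rewrite leq_max -(ler_nat rat) {1}rE W_weightE h.
have Ale x i : (0 < i)%N -> (2 * i <= q)%N ->
    (x%:R <= A_weight (k%:R : rat) q t i)%R ->
    (x <= maxn (W r t k.+1) (\max_(1 <= i < (q %/ 2).+1) A i t k.+1 r))%N.
  move=> i0 iq h; rewrite leq_max; apply/orP; right.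
  apply: (@leq_trans (A i t k.+1 r)).
    by rewrite -(ler_nat rat) rE A_weightE.
  apply: (@leq_bigmax_seq _ _ _ (fun i => A i t k.+1 r)) => //.
  by rewrite mem_index_iota i_range i0.
have [h|[H [vH cH wH]]] := card_le_weight_or_W rat k0 ht1 rE tF nF.
  exact: Wle.
have Dc : #|[set: 'I_r]| = (q + t)%N by rewrite cardsT card_ord.
(* Here [k = n - 1]: up to [t] some [A] is the bound; beyond [t], non-triviality of [H] leads to [W]
   or to [A] with [i = 1]. *)
have [kt|tk] := leqP k t.
  have [||i [i0 iq wi]] := @weight_le_A_weight rat k%:R%R _ q t _ _ q1 _ _ Dc vH.
  - by rewrite ler1n.
  - by rewrite ler_nat.
  by apply: (Ale _ i) => //; apply: le_trans wH wi.
have tk' : (t.+1%:R <= k%:R :> rat)%R by rewrite ler_nat.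
have [_ [h|h]] := nontrivial_weight_le ht1 tk' Dc vH cH.
  by apply: Wle; apply: le_trans wH h.
by apply: (Ale _ 1%N) => //; apply: le_trans wH h.
Qed.
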